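(* Let $d,n\in\mathbb{N}$ and $s\in\mathbb{N}$. For every $p_{\mathbf{X}}\in\mathcal{E}[0,1]^d_n$ there exists a ReLU network $\Psi\in\mathcal{N}_{1,d}$ with connectivity $\mathcal{M}(\Psi)\le 22\cdot2^d(n^d+n^{d-1}s)$ and depth $\mathcal{L}(\Psi)=(d-1)(s+3)+2$ such that \[ W(\Psi\#U,\,p_{\mathbf{X}})\le\frac{\sqrt d}{n2^s}. \]
   Context: $\mathcal{E}[0,1]^d_n$: densities $p(\mathbf{x})=\sum_{\mathbf{k}\in\{0,\dots,n-1\}^d}w_{\mathbf{k}}\chi_{c_{\mathbf{k}}}(\mathbf{x})$ with $c_{\mathbf{k}}=\prod_{j=1}^d[i_j/n,(i_j+1)/n]$ for $\mathbf{k}=(i_1,\dots,i_d)$, all $w_{\mathbf{k}}>0$ and $\sum_{\mathbf{k}}w_{\mathbf{k}}=n^d$. A ReLU network of depth $L\ge2$ is $\Phi=W_L\circ\rho\circ W_{L-1}\circ\cdots\circ\rho\circ W_1$ with affine $W_\ell(x)=A_\ell x+b_\ell$ and $\rho(x)=\max(x,0)$ componentwise; $\mathcal{L}(\Phi)=L$; $\mathcal{M}(\Phi)$ is the total number of nonzero entries of all $A_\ell,b_\ell$; $\mathcal{N}_{d,d'}$ is the set of such networks with input dimension $d$ and output dimension $d'$. $U$ is uniform on $[0,1]$, $\#$ is push-forward, and $W$ is the 1-Wasserstein distance $W(\mu,\nu)=\inf_\pi\int|x-y|d\pi$ over couplings of $\mu,\nu$ with Euclidean norm. *)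

(* Defs.v *)
From HB Require Import structures.
From mathcomp Require Import all_boot all_order all_algebra.
From mathcomp Require Import all_classical all_reals all_analysis.
Import Order.TTheory GRing.Theory Num.Theory.
Import numFieldNormedType.Exports.

Set Implicit Arguments.
Unset Strict Implicit.
Unset Printing Implicit Defensive.

Local Open Scope classical_set_scope.
Local Open Scope ring_scope.

Inductive relu_net (R : Type) : nat -> nat -> Type :=
| NetLast (m k : nat) of 'M[R]_(m, k) & 'rV[R]_k : relu_net R m k
| NetCons (m h k : nat) of 'M[R]_(m, h) & 'rV[R]_h & relu_net R h k
    : relu_net R m k.

Definition relu (R : realDomainType) (m : nat) (v : 'rV[R]_m) : 'rV[R]_m :=
  map_mx (fun x => Num.max x 0) v.

Fixpoint net_eval (R : realDomainType) (m k : nat) (N : relu_net R m k)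
  : 'rV[R]_m -> 'rV[R]_k :=
  match N in relu_net _ m k return 'rV[R]_m -> 'rV[R]_k with
  | NetLast _ _ A b => fun x => x *m A + b
  | NetCons _ _ _ A b N' => fun x => net_eval N' (relu (x *m A + b))
  end.

Fixpoint net_depth (R : Type) (m k : nat) (N : relu_net R m k) : nat :=
  match N with
  | NetLast _ _ _ _ => 1
  | NetCons _ _ _ _ _ N' => (net_depth N').+1
  end.

Definition nnz (R : nzRingType) (m k : nat) (A : 'M[R]_(m, k)) : nat :=
  (\sum_(i < m) \sum_(j < k) nat_of_bool (A i j != 0%R))%N.

Fixpoint net_conn (R : nzRingType) (m k : nat) (N : relu_net R m k) : nat :=
  match N with
  | NetLast _ _ A b => (nnz A + nnz b)%N
  | NetCons _ _ _ A b N' => (nnz A + nnz b + net_conn N')%N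
  end.

Definition net_fun1 (R : realDomainType) (d : nat) (N : relu_net R 1 d)
  : R -> 'rV[R]_d := fun t => net_eval N (const_mx t).

Definition Rd (R : realType) (d : nat) :=
  g_sigma_algebraType (open : set (set 'rV[R]_d)).

Definition enorm (R : realType) (d : nat) (v : 'rV[R]_d) : R :=
  Num.sqrt (\sum_(i < d) v ord0 i ^+ 2).

Definition is_coupling (R : realType) (d : nat)
  (P : probability (Rd R d * Rd R d)%type R)
  (mu nu : set (Rd R d) -> \bar R) : Prop :=
  forall A : set (Rd R d), measurable A ->
    P (fst @^-1` A) = mu A /\ P (snd @^-1` A) = nu A.

Definition wasserstein1 (R : realType) (d : nat)
  (mu nu : set (Rd R d) -> \bar R) : \bar R :=
  ereal_inf [set (\int[P]_z (enorm ((z.1 : 'rV[R]_d) - z.2))%:E)%E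
            | P in [set P : probability (Rd R d * Rd R d)%type R
                    | is_coupling P mu nu]].

Definition push_unif (R : realType) (d : nat) (f : R -> 'rV[R]_d)
  : set (Rd R d) -> \bar R :=
  fun A => lebesgue_measure (`[(0:R), 1] `&` (f @^-1` A)).

(* Lebesgue integral over R^d of a nonnegative function, as the iterated
   integral (Tonelli) over the coordinates *)
Fixpoint lebesgue_int (R : realType) (d : nat) : ('rV[R]_d -> \bar R) -> \bar R :=
  match d return ('rV[R]_d -> \bar R) -> \bar R with
  | 0 => fun f => f 0
  | d'.+1 => fun f =>
      (\int[lebesgue_measure]_(t in [set: R])
         lebesgue_int (fun v : 'rV[R]_d' => f (row_mx (const_mx t : 'rV[R]_1) v)))%E
  end.

Definition dens_measure (R : realType) (d : nat) (p : 'rV[R]_d -> R)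
  : set (Rd R d) -> \bar R :=
  fun A => lebesgue_int (fun x => (p x * \1_A x)%:E).

Definition in_cube (R : realType) (d n : nat) (k : {ffun 'I_d -> 'I_n})
  (x : 'rV[R]_d) : bool :=
  [forall j : 'I_d, ((k j)%:R / n%:R <= x ord0 j <= (k j).+1%:R / n%:R)].

Definition pw_density (R : realType) (d n : nat) (w : {ffun 'I_d -> 'I_n} -> R)
  : 'rV[R]_d -> R :=
  fun x => \sum_(k : {ffun 'I_d -> 'I_n}) w k * (if in_cube k x then 1 else 0).

Definition in_E (R : realType) (d n : nat) (p : 'rV[R]_d -> R) : Prop :=
  exists w : {ffun 'I_d -> 'I_n} -> R,
    (forall k, 0 < w k) /\
    \sum_(k : {ffun 'I_d -> 'I_n}) w k = n%:R ^+ d /\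
    p = pw_density w.

(* Main.v *)
Require Import Defs.
From HB Require Import structures.
From mathcomp Require Import all_boot all_order all_algebra.
From mathcomp Require Import all_classical all_reals all_analysis.
From mathcomp Require Import measurable_realfun ring lra zify.
Import Order.TTheory GRing.Theory Num.Theory.
Import numFieldNormedType.Exports.

(** Position inside a cell of the first marginal is read off by clamping an
    affine function of the input, and the [s]-fold sawtooth turns that position
    into a fresh uniform variable for the conditional histogram of the remaining
    coordinates.  On each of the [n * 2 ^ s] branches of this recursion the
      input
    is an affine image of the fresh variable, so a coupling of the fresh
      variable
    with the conditional histogram, together with an independent uniform
      variable
    placed in the same dyadic cell, pushes forward to a coupling of the input
      with
    the full histogram.  Almost surely under this coupling, the network output
      and
    the target agree up to [1 / (n * 2 ^ s)] in every coordinate. *)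

Set Implicit Arguments.
Unset Strict Implicit.
Unset Printing Implicit Defensive.
Local Open Scope classical_set_scope.
Local Open Scope ring_scope.

(** * Networks indexed by finite types *)

Section Realizes.
Context {R : realType} {d : nat}.

(** The obstacle is that one scalar drives all coordinates. On a branch of the recursion, the first
    output coordinate and the fresh variable handed to the remaining coordinates are functions of
    each other, whereas under the target the position in the cell is independent of the remaining
    coordinates given the cell. Passing to an independent position in the same dyadic cell changes
    that one coordinate only, and the fresh variable stays exactly uniform. Hence errors do not
    accumulate over the levels, and the Euclidean norm of [d] equal bounds gives the factor
    [sqrt d]. A level with a sawtooth takes [s + 3] layers: two for clamping, one to split the
    position into two neurons, [s - 1] fused sawtooth steps, one to recombine. The last level takes
    two. The sawtooth runs on the first [d - 1] levels only, with at most [n ^ (d - 1)] cells each,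
    hence the term [n ^ (d - 1) * s]; the clamps of the last level give [n ^ d]. The factor [2 ^ d]
    absorbs the number of levels and the cost of carrying [d] coordinates through every layer. *)

Definition layer_cost (I J : finType) (A : I -> J -> R) (b : J -> R) : nat :=
  (\sum_j (\sum_i (A i j != 0%R) + (b j != 0%R)))%N.

Definition affine (I J : finType) (A : I -> J -> R) (b : J -> R) (x : I -> R)
  : J -> R := fun j => \sum_i x i * A i j + b j.

Definition layer (I J : finType) (A : I -> J -> R) (b : J -> R) (x : I -> R)
  : J -> R := fun j => Num.max (affine A b x j) 0.

Definition vec (I : finType) (x : I -> R) : 'rV[R]_#|I| :=
  \row_i x (enum_val i).

(** The condition [P] restricts where [F] describes the network. It will be nonnegativity of the
    output coordinates, which lets a ReLU layer carry them unchanged. [C] is only an upper bound,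
    while the depth [D] is exact. *)
Definition realizes (I : finType) (D C : nat) (P : (I -> R) -> Prop)
    (F : (I -> R) -> 'I_d -> R) : Prop :=
  exists N : relu_net R #|I| d,
    [/\ (net_conn N <= C)%N, net_depth N = D
      & forall x, P x -> net_eval N (vec x) = \row_j F x j].

Lemma nnz_reindex (I J : finType) k (e : 'I_k -> J) (A : I -> J -> R)
    (b : J -> R) : bijective e ->
  (nnz (\matrix_(i < #|I|, j < k) A (enum_val i) (e j)) +
   nnz (\row_(j < k) b (e j)) = layer_cost A b)%N.
Proof.
move=> be; rewrite /nnz big_ord1 exchange_big -big_split /= /layer_cost.
rewrite [RHS](reindex e) /=; last exact: onW_bij.
apply: eq_bigr => j _; rewrite mxE; congr addn.
rewrite [RHS](reindex (@enum_val I predT)) /=; last exact/onW_bij/enum_val_bij.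
by apply: eq_bigr => i _; rewrite mxE.
Qed.

Lemma vec_affine (I J : finType) k (e : 'I_k -> J) (A : I -> J -> R)
    (b : J -> R) (x : I -> R) :
  vec x *m (\matrix_(i < #|I|, j < k) A (enum_val i) (e j)) +
  \row_(j < k) b (e j) = \row_j affine A b x (e j).
Proof.
apply/rowP => j; rewrite !mxE; congr (_ + _).
rewrite [RHS](reindex (@enum_val I predT)) /=; last exact/onW_bij/enum_val_bij.
by apply: eq_bigr => i _; rewrite !mxE.
Qed.

Lemma realizes_last (I : finType) (A : I -> 'I_d -> R) (b : 'I_d -> R) :
  realizes 1 (layer_cost A b) (fun=> True) (affine A b).
Proof.
exists (NetLast (\matrix_(i, j) A (enum_val i) j) (\row_j b j)).
split=> //=; first by rewrite (@nnz_reindex _ _ _ id)//; exists id.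
by move=> x _; rewrite (vec_affine id).
Qed.

Lemma realizes_cons (I J : finType) (A : I -> J -> R) (b : J -> R) D C P F :
  @realizes J D C P F ->
  realizes D.+1 (layer_cost A b + C) (P \o layer A b) (F \o layer A b).
Proof.
move=> [N [NC ND NF]].
exists (NetCons (\matrix_(i, j) A (enum_val i) (enum_val j))
  (\row_j b (enum_val j)) N); split=> /=.
- by rewrite nnz_reindex ?leq_add2l//; exact: enum_val_bij.
- by rewrite ND.
- move=> x Px; rewrite -NF// vec_affine; congr net_eval.
  by apply/rowP => j; rewrite !mxE.
Qed.

Lemma realizes_ext (I : finType) D D' C C' (P P' : (I -> R) -> Prop) F F' :
  realizes D C P F -> D = D' -> (C <= C')%N ->
  (forall x, P' x -> P x /\ F x =1 F' x) -> realizes D' C' P' F'.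
Proof.
move=> [N [NC ND NF]] <- CC' PP'; exists N; split=> //.
  exact: leq_trans NC CC'.
by move=> x /PP'[Px FF']; rewrite NF//; apply/rowP => j; rewrite !mxE FF'.
Qed.

End Realizes.

Lemma nnz_row (R : nzRingType) m k (i : 'I_m) (A : 'M[R]_(m, k)) :
  (nnz (row i A) <= nnz A)%N.
Proof.
rewrite /nnz big_ord1 (bigD1 i)//= (eq_bigr (fun j => nat_of_bool (A i j !=
  0))).
  exact: leq_addr.
by move=> j _; rewrite mxE.
Qed.

(** Feeding 0 to all inputs but [i] leaves only row [i] of the first matrix, and dropping rows
    creates no nonzero entry. *)
Lemma net_restrict_input (R : realDomainType) m k (N : relu_net R m k)
    (i : 'I_m) :
  exists N' : relu_net R 1 k, [/\ (net_conn N' <= net_conn N)%N,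
    net_depth N' = net_depth N
    & forall t, net_eval N' (const_mx t) = net_eval N (t *: delta_mx 0 i)].
Proof.
have rowE m' k' (j : 'I_m') (A : 'M[R]_(m', k')) t :
    const_mx t *m row j A = (t *: delta_mx (0 : 'I_1) j) *m A.
  rewrite -scalemxAl -rowE; apply/matrixP => a b.
  by rewrite !mxE big_ord1 !mxE.
case: m k / N i => [m k A b i|m h k A b N i].
  exists (NetLast (row i A) b); split=> //= [|t]; last by rewrite rowE.
  by rewrite leq_add2r nnz_row.
exists (NetCons (row i A) b N); split=> //= [|t]; last by rewrite rowE.
by rewrite !leq_add2r nnz_row.
Qed.

(** * Layer matrices acting on states: their effect and their cost *)

Section Construction.
Context {R : realType} {d : nat}.

(* A state carries the [d] output coordinates and one signal per cell [k : K];
   with [K * bool] in place of [K], two neurons per cell represent a signal. *)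
Definition state (K : finType) (y : 'I_d -> R) (u : K -> R) : 'I_d + K -> R :=
  fun z => match z with inl a => y a | inr k => u k end.

Lemma state_eta (K : finType) (x : 'I_d + K -> R) :
  x = state (x \o inl) (x \o inr).
Proof. by apply/funext => -[]. Qed.

(** A new cell [k'] reads the single signal [f k']; its two neurons share the weight [al k'] and
    differ only in their biases. This serves both the clamp and the start of the sawtooth. *)
Definition split_mx (K K' : finType) (f : K' -> K) (al : K' -> R)
    (s : 'I_d + K) (t : 'I_d + K' * bool) : R :=
  match s, t with
  | inl a, inl a' => (a == a')%:R
  | inr k, inr ke => (k == f ke.1)%:R * al ke.1
  | _, _ => 0
  end.

Definition split_bias (K' : finType) (be : K' * bool -> R)
    (t : 'I_d + K' * bool) : R :=
  match t with inl _ => 0 | inr ke => be ke end.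

(** The two neurons of a cell are recombined twice: with weights [p] into the next signal, and with
    weights [la] into a contribution to the output coordinate [c]. *)
Definition merge_mx (K : finType) (c : 'I_d) (la p : bool -> R)
    (s : 'I_d + K * bool) (t : 'I_d + K) : R :=
  match s, t with
  | inl a, inl a' => (a == a')%:R
  | inr ke, inl a => (a == c)%:R * la ke.2
  | inr ke, inr k => (ke.1 == k)%:R * p ke.2
  | _, _ => 0
  end.

(** Fuses a recombination with the next splitting into one affine map, so that an iteration of the
    sawtooth costs one layer. *)
Definition step_mx (K : finType) (p : bool -> R)
    (s : 'I_d + K * bool) (t : 'I_d + K * bool) : R :=
  match s, t with
  | inl a, inl a' => (a == a')%:R
  | inr ke, inr ke' => (ke.1 == ke'.1)%:R * p ke.2
  | _, _ => 0
  end.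

Definition out_mx (K : finType) (c : 'I_d) (la : bool -> R)
    (s : 'I_d + K * bool) (a : 'I_d) : R :=
  match s with
  | inl a' => (a' == a)%:R
  | inr ke => (a == c)%:R * la ke.2
  end.

Lemma sum_pair_bool (V : nmodType) (K : finType) (F : K * bool -> V) :
  \sum_ke F ke = \sum_k (F (k, true) + F (k, false)).
Proof.
rewrite (eq_bigr (fun k => F (k.1, k.2))); last by case.
rewrite -(pair_bigA _ (fun k e => F (k, e))) /=.
by apply: eq_bigr => k _; rewrite big_bool.
Qed.

Lemma sum_delta (K : finType) (k : K) (F : K -> R) :
  \sum_i F i * (i == k)%:R = F k.
Proof.
rewrite (bigD1 k)//= eqxx mulr1 big1 ?addr0// => i /negbTE->.
by rewrite mulr0.
Qed.

Lemma split_layerE (K K' : finType) (f : K' -> K) al be y u :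
  layer (split_mx f al) (split_bias be) (state y u) =
  state (fun a => Num.max (y a) 0)
    (fun ke => Num.max (al ke.1 * u (f ke.1) + be ke) 0).
Proof.
apply/funext => -[a|ke]; rewrite /layer /affine big_sumType /=.
  rewrite (sum_delta a) big1 ?addr0// => i _; exact: mulr0.
rewrite big1 ?add0r => [|i _]; last exact: mulr0.
congr (Num.max (_ + _) _).
rewrite -[RHS](sum_delta (f ke.1) (fun k => al ke.1 * u k)).
by apply: eq_bigr => i _; ring.
Qed.

Lemma merge_layerE (K : finType) c la p y (u : K * bool -> R) :
  layer (merge_mx c la p) (fun=> 0) (state y u) =
  state (fun a => Num.max (y a + (a == c)%:R *
           \sum_k (la true * u (k, true) + la false * u (k, false))) 0)
    (fun k => Num.max (p true * u (k, true) + p false * u (k, false)) 0).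
Proof.
apply/funext => -[a|k]; rewrite /layer /affine big_sumType /= addr0.
  rewrite (sum_delta a) sum_pair_bool /= big_distrr /=;
    congr (Num.max (_ + _) _).
  by apply: eq_bigr => i _; ring.
rewrite big1 ?add0r => [|i _]; last exact: mulr0.
rewrite sum_pair_bool /=; congr Num.max; rewrite -[RHS](sum_delta k (fun k =>
  p true * u (k, true) + p false * u (k, false))).
by apply: eq_bigr => i _; ring.
Qed.

Lemma step_layerE (K : finType) p be y (u : K * bool -> R) :
  layer (step_mx p) (split_bias be) (state y u) =
  state (fun a => Num.max (y a) 0)
    (fun ke => Num.max (p true * u (ke.1, true) + p false * u (ke.1, false)
      + be ke) 0).
Proof.
apply/funext => -[a|ke]; rewrite /layer /affine big_sumType /=.
  by rewrite (sum_delta a) big1 ?addr0// => i _; exact: mulr0.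
rewrite big1 ?add0r => [|i _]; last exact: mulr0.
rewrite sum_pair_bool /=; congr (Num.max (_ + _) _).
rewrite -[RHS](sum_delta ke.1 (fun k =>
  p true * u (k, true) + p false * u (k, false))).
by apply: eq_bigr => i _; ring.
Qed.

Lemma out_affineE (K : finType) c la y (u : K * bool -> R) :
  affine (out_mx c la) (fun=> 0) (state y u) = fun a => y a + (a == c)%:R *
           \sum_k (la true * u (k, true) + la false * u (k, false)).
Proof.
apply/funext => a; rewrite /affine big_sumType /= addr0.
rewrite (sum_delta a) sum_pair_bool /= big_distrr /=; congr (_ + _).
by apply: eq_bigr => i _; ring.
Qed.

Lemma fanin_le (I : finType) (r : seq I) (F : I -> R) :
  (forall i, i \notin r -> F i = 0) -> (\sum_i (F i != 0%R) <= size r)%N.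
Proof.
move=> F0; apply: leq_trans (card_size r).
rewrite (_ : \sum_i _ = #|[pred i | F i != 0%R]|)%N; last first.
  by rewrite -sum1_card [RHS]big_mkcond; apply: eq_bigr => i _; rewrite inE;
    case: eqP.
apply: subset_leq_card; apply/fintype.subsetP => i; rewrite inE.
by apply: contraNT => /F0->.
Qed.

Lemma sum_leqC (I : finType) (F : I -> nat) (c : nat) :
  (forall i, F i <= c)%N -> (\sum_i F i <= c * #|I|)%N.
Proof. by move=> Fc; rewrite mulnC -sum_nat_const; exact: leq_sum. Qed.

Lemma carry_cost (a : 'I_d) : (\sum_(i < d) ((i == a)%:R != 0%R :> R) <= 1)%N.
Proof.
by apply: (@fanin_le _ [:: a]) => i; rewrite inE => /negbTE->.
Qed.

Lemma split_cost (K K' : finType) (f : K' -> K) al be :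
  (layer_cost (split_mx f al) (split_bias be) <= d + 4 * #|K'|)%N.
Proof.
rewrite /layer_cost big_sumType /= leq_add//.
  rewrite -[leqRHS](@card_ord d) -[leqRHS]mul1n; apply: sum_leqC => a.
  rewrite big_sumType /= eqxx addn0 [X in (_ + X)%N]big1 ?addn0 ?carry_cost//
    => i _;
    rewrite ?eqxx.
rewrite (_ : 4 * #|K'| = 2 * #|{: K' * bool}|)%N; last first.
  by rewrite card_prod card_bool mulnCA mulnC.
apply: sum_leqC => -[k e]; rewrite big_sumType /= big1 ?add0n; last first.
  by move=> i _ /=; rewrite ?eqxx.
rewrite (@leq_add _ _ 1 1) ?leq_b1//.
by apply: (@fanin_le _ [:: f k]) => i; rewrite inE => /negbTE->; rewrite mul0r.
Qed.

(** Only coordinate [c] receives signals, so the neurons of the cells are counted once and not [d]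
    times. *)
Lemma coord_cost (K : finType) (c : 'I_d) (la : bool -> R) :
  (\sum_(a < d) (\sum_(i < d) ((i == a)%:R != 0%R :> R) +
     \sum_(ke : K * bool) ((a == c)%:R * la ke.2 != 0 :> R)%R)
   <= d + 2 * #|K|)%N.
Proof.
rewrite big_split /= leq_add//.
  by rewrite -[leqRHS](@card_ord d) -[leqRHS]mul1n; apply: sum_leqC => a;
    exact: carry_cost.
rewrite (bigD1 c)//= [X in (_ + X)%N]big1 ?addn0 => [|a /negbTE->]; last first.
  by apply: big1 => i _; rewrite mul0r eqxx.
rewrite -card_bool mulnC -card_prod -[leqRHS]mul1n.
by apply: sum_leqC => i; exact: leq_b1.
Qed.

Lemma merge_cost (K : finType) c la p :
  (layer_cost (@merge_mx K c la p) (fun=> 0%R) <= d + 4 * #|K|)%N.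
Proof.
rewrite /layer_cost big_sumType /= (_ : 4 * _ = 2 * #|K| + 2 * #|K|)%N;
  last first.
  by rewrite -mulnDl.
rewrite addnA leq_add//.
  rewrite (leq_trans _ (coord_cost K c la))//; apply: leq_sum => a _.
  by rewrite eqxx addn0 big_sumType.
apply: sum_leqC => k; rewrite big_sumType /= eqxx addn0 big1 ?add0n; last first.
  by move=> i _ /=; rewrite ?eqxx.
apply: (@fanin_le _ [:: (k, true); (k, false)]) => -[i []];
  rewrite !inE !xpair_eqE/= ?andbT ?andbF ?orbF ?orFb => /negbTE->;
  by rewrite mul0r.
Qed.

Lemma step_cost (K : finType) p be :
  (layer_cost (@step_mx K p) (split_bias be) <= d + 6 * #|K|)%N.
Proof.
rewrite /layer_cost big_sumType /= leq_add//.
  rewrite -[leqRHS](@card_ord d) -[leqRHS]mul1n; apply: sum_leqC => a.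
  rewrite big_sumType /= eqxx addn0 [X in (_ + X)%N]big1 ?addn0 ?carry_cost//
    => i _;
    rewrite ?eqxx.
rewrite (_ : 6 * #|K| = 3 * #|{: K * bool}|)%N; last first.
  by rewrite card_prod card_bool mulnCA mulnC.
apply: sum_leqC => -[k e]; rewrite big_sumType /= big1 ?add0n; last first.
  by move=> i _ /=; rewrite ?eqxx.
rewrite (@leq_add _ _ 2 1) ?leq_b1//.
apply: (@fanin_le _ [:: (k, true); (k, false)]) => -[i []];
  rewrite !inE !xpair_eqE/= ?andbT ?andbF ?orbF ?orFb => /negbTE->;
  by rewrite mul0r.
Qed.

Lemma out_cost (K : finType) c la :
  (layer_cost (@out_mx K c la) (fun=> 0%R) <= d + 2 * #|K|)%N.
Proof.
rewrite (leq_trans _ (coord_cost K c la))//; apply: leq_sum => a _.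
by rewrite eqxx addn0 big_sumType.
Qed.

End Construction.

(** * The histogram network *)

Section Histogram.
Context {R : realType} {n : nat}.

Definition hist (r : nat) := {ffun 'I_r -> 'I_n} -> R.

Definition ffcons r (i : 'I_n) (k : {ffun 'I_r -> 'I_n}) : {ffun 'I_r.+1 ->
  'I_n} :=
  [ffun j => if unlift ord0 j is Some j' then k j' else i].

Definition subhist r (w : hist r.+1) (i : 'I_n) : hist r :=
  fun k => w (ffcons i k).

Definition total r (w : hist r) : R := \sum_k w k.

Lemma sum_ffcons (V : nmodType) r (F : {ffun 'I_r.+1 -> 'I_n} -> V) :
  \sum_k F k = \sum_i \sum_k F (ffcons i k).
Proof.
rewrite pair_bigA /=; apply: (reindex (fun p => ffcons p.1 p.2)).
exists (fun k : {ffun 'I_r.+1 -> 'I_n} =>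
  (k ord0, [ffun j : 'I_r => k (lift ord0 j)])) => [[i k] _|k _] /=.
  by congr pair; [rewrite ffunE unlift_none|apply/ffunP => j;
    rewrite !ffunE liftK].
by apply/ffunP => j; rewrite ffunE; case: unliftP => [j'|] ->; rewrite ?ffunE.
Qed.

Lemma total_subhist r (w : hist r.+1) : total w = \sum_i total (subhist w i).
Proof. exact: sum_ffcons. Qed.

(** Truncation of the affine function to [[0, 1]], written with two ReLUs. *)
Definition clamp (al be u : R) : R :=
  Num.max (al * u + be) 0 - Num.max (al * u + be - 1) 0.

(** The tent map on [[0, 1]]. It becomes negative beyond 1, so iterating it relies on the argument
    staying in the unit interval. *)
Definition saw (v : R) : R := 2 * Num.max v 0 - 4 * Num.max (v - 2^-1) 0.

(** With [cell_shift], the affine map that takes the [i]-th interval of the cumulated first marginal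
    onto [[0, 1]]. Both are ratios of masses, so sub-histograms never need to be renormalized. *)
Definition cell_slope r (w : hist r.+1) (i : 'I_n) : R :=
  total w / total (subhist w i).

Definition cell_shift r (w : hist r.+1) (i : 'I_n) : R :=
  - ((\sum_(i' < n | (i' < i)%N) total (subhist w i')) / total (subhist w i)).

Definition cell_pos r (w : hist r.+1) (i : 'I_n) (u : R) : R :=
  clamp (cell_slope w i) (cell_shift w i) u.

(** Coordinate 0 is the piecewise linear quantile function of the first marginal. The coordinate is
    a natural number so that [level_net] can address it as an offset [a - c]. *)
Fixpoint hist_map (s r : nat) : hist r -> R -> nat -> R :=
  match r with
  | 0 => fun _ _ _ => 0
  | r'.+1 => fun w u j =>
      match j with
      | 0 => \sum_i cell_pos w i u / n%:R
      | j'.+1 => \sum_i @hist_map s r' (subhist w i) (iter s saw (cell_pos w i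
        u)) j'
      end
  end.

Lemma clamp01 al be u : 0 <= clamp al be u <= 1.
Proof.
by rewrite /clamp; set x := al * u + be; rewrite /Num.max; case: ifP; case: ifP;
  lra.
Qed.

Lemma saw01 v : 0 <= v <= 1 -> 0 <= saw v <= 1.
Proof. by rewrite /saw /Num.max => ?; case: ifP; case: ifP; lra. Qed.

Lemma iter_saw01 s v : 0 <= v <= 1 -> 0 <= iter s saw v <= 1.
Proof. by move=> v01; elim: s => //= s; exact: saw01. Qed.

End Histogram.

(** * The network of all levels and its size *)

Section LevelNet.
Context {R : realType} {d n : nat}.
Local Notation hist := (@hist R n).

Lemma realizes_iter (I : finType) (A : I -> I -> R) b m D C P F :
  @realizes R d I D C P F ->
  realizes (m + D) (m * layer_cost A b + C) (P \o iter m (layer A b))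
    (F \o iter m (layer A b)).
Proof.
move=> N; elim: m => [|m ih]; first exact: (realizes_ext N).
apply: (realizes_ext (realizes_cons A b ih)) => //.
  by rewrite mulSn addnA.
by move=> x Px; rewrite /comp/= -iterSr.
Qed.

Definition saw_bias (K : finType) (ke : K * bool) : R :=
  if ke.2 then - 2^-1 else 0.

Definition saw_coef (e : bool) : R := if e then - 4 else 2.

(** The two-neuron form of a signal that is about to enter [saw]; the sawtooth layers keep signals
    in this form between iterations. *)
Definition halves (K : finType) (v : K -> R) (ke : K * bool) : R :=
  Num.max (v ke.1 + saw_bias ke) 0.

Lemma saw_halves (K : finType) (v : K -> R) k :
  saw_coef true * halves v (k, true) + saw_coef false * halves v (k, false) =
  saw (v k).
Proof. by rewrite /saw /halves /saw_bias /saw_coef /= addr0; ring. Qed.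

Lemma iter_saw_layer (K : finType) m (y : 'I_d -> R) (v : K -> R) :
  (forall a, 0 <= y a) ->
  iter m (layer (step_mx saw_coef) (split_bias (@saw_bias K)))
    (state y (halves v)) = state y (halves (iter m saw \o v)).
Proof.
move=> y0; elim: m => //= m ->; rewrite step_layerE.
by apply/funext => -[a|ke] /=; [rewrite max_l|rewrite saw_halves].
Qed.

Definition clamp_coef (e : bool) : R := if e then - 1 else 1.

Lemma clamp_split (x al be u : R) :
  clamp_coef true * x * Num.max (al * u + (be - true%:R)) 0 +
  clamp_coef false * x * Num.max (al * u + (be - false%:R)) 0 =
  clamp al be u * x.
Proof. by rewrite /clamp /clamp_coef subr0 addrA; ring. Qed.

(* The formula holds for arbitrary signals: since [hist_map] vanishes at [0],
   inactive cells contribute nothing and no activity invariant is needed. *)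
Lemma level_net r (K : finType) (w : K -> hist r.+1) (s : nat) (c : 'I_d) :
  (0 < n)%N -> (0 < s)%N -> (c + r.+1 = d)%N ->
  realizes (r * (s + 3) + 2)
    (r * (s + 3) * d + r * (10 + 6 * s) * n ^ r * #|K| + 2 * d
      + 6 * n ^ r.+1 * #|K|)
    (fun x : 'I_d + K -> R => forall a, 0 <= x (inl a))
    (fun x a => x (inl a) + if (c <= a)%N then
       \sum_k hist_map s (w k) (x (inr k)) (a - c) else 0).
Proof.
move=> n0 s0; elim: r K w c => [|r ih] K w c cd.
  have N := realizes_cons (split_mx (fun ki : K * 'I_n => ki.1)
      (fun ki => cell_slope (w ki.1) ki.2))
    (split_bias (fun kie => cell_shift (w kie.1.1) kie.1.2 - kie.2%:R))
    (realizes_last (out_mx c (fun e => clamp_coef e * n%:R^-1)) (fun=> 0)).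
  apply: (realizes_ext N) => //.
    rewrite (leq_trans (leq_add (split_cost _ _ _) (out_cost _ _ _)))//.
    by rewrite card_prod card_ord; lia.
  move=> x x0; split=> // a.
  rewrite /comp [x in affine _ _ (layer _ _ x)]state_eta split_layerE
    out_affineE.
  rewrite /= max_l ?x0//; congr (_ + _).
  under eq_bigr do rewrite clamp_split.
  (* Here [c] is the last coordinate, since [c + 1 = d], so no [a] lies beyond it. *)
  have [->|ac] := eqVneq a c.
    by rewrite leqnn subnn mul1r pair_bigA.
  rewrite mul0r; case: leqP => // ca.
  have ad := ltn_ord a; have {}ca : (c < a)%N by rewrite ltn_neqAle eq_sym ac.
  exfalso; lia.
have c1d : (c.+1 < d)%N by lia.
pose w' (ki : K * 'I_n) : hist r.+1 := subhist (w ki.1) ki.2.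
have c1rd : (c.+1 + r.+1)%N = d by lia.
have {ih} N0 := ih _ w' (Ordinal c1d) c1rd.
(* The layers of the level are prepended from the last to the first. This one completes the [s]-th
   sawtooth, hence [s.-1] fused steps before it; its [la] is 0 because coordinate [c] has already
   been written by the clamp. *)
have N1 := realizes_cons (merge_mx c (fun=> 0) saw_coef) (fun=> 0) N0.
have {N0} N2 := realizes_iter (step_mx saw_coef) (split_bias (@saw_bias _))
  s.-1 N1.
have {N1} N3 := realizes_cons (split_mx id (fun=> 1)) (split_bias (@saw_bias
  _)) N2.
have {N2} N4 := realizes_cons
  (merge_mx c (fun e => clamp_coef e * n%:R^-1) clamp_coef) (fun=> 0) N3.
have {N3} N := realizes_cons (split_mx (fun ki : K * 'I_n => ki.1)
      (fun ki => cell_slope (w ki.1) ki.2))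
    (split_bias (fun kie => cell_shift (w kie.1.1) kie.1.2 - kie.2%:R)) N4.
apply: (realizes_ext N).
- by rewrite mulSn; lia.
- have C1 := split_cost (d := d) (fun ki : K * 'I_n => ki.1)
      (fun ki => cell_slope (w ki.1) ki.2)
    (fun kie => cell_shift (w kie.1.1) kie.1.2 - kie.2%:R).
  have C2 := merge_cost (K * 'I_n)%type c
    (fun e => clamp_coef e * n%:R^-1) clamp_coef.
  have C3 := @split_cost R d (K * 'I_n)%type _ id (fun=> 1) (@saw_bias _).
  have C4 := @step_cost R d (K * 'I_n)%type saw_coef (@saw_bias _).
  have C5 := merge_cost (K * 'I_n)%type c (fun=> 0) saw_coef.
  rewrite (leq_trans (leq_add C1 (leq_add C2 (leq_add C3 (leq_add
    (leq_mul (leqnn _) C4) (leq_add C5 (leqnn _)))))))//.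
  have nX : (0 < n ^ r)%N by rewrite expn_gt0 n0.
  (* The layers of this level cost [16 + 6 * (s - 1) = 10 + 6 * s] per cell. Bounding its cell count
     by that of the largest sawtooth level introduces the factor [X]. *)
  rewrite card_prod card_ord !expnS; clear -s0 nX; case: s s0 => // m _ /=.
  move: (n ^ r)%N nX => X X0.
  have : ((16 + 6 * m) * (#|K| * n) <= (16 + 6 * m) * (#|K| * n) * X)%N.
    exact: leq_pmulr.
  move: #|K| => k h; nia.
move=> x x0.
pose v (ki : K * 'I_n) := cell_pos (w ki.1) ki.2 (x (inr ki.1)).
have v01 ki : 0 <= v ki <= 1 by exact: clamp01.
pose y (a : 'I_d) := x (inl a) + (a == c)%:R * \sum_ki v ki / n%:R.
have y0 a : 0 <= y a.
  rewrite addr_ge0// mulr_ge0// sumr_ge0// => ki _.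
  by rewrite mulr_ge0//; have /andP[] := v01 ki.
rewrite /comp; set z := layer (merge_mx c (fun=> 0) saw_coef) _ _.
(* [z] is the state after the whole level: the positions have been added to coordinate [c], and the
   signals are the fresh variables for the next level. *)
have -> : z = state y (iter s saw \o v).
  rewrite /z (state_eta x) split_layerE merge_layerE.
  rewrite split_layerE.
  rewrite [X in iter _ _ X](_ : _ = state y (halves v)); last first.
    apply/funext => -[a|[ki e]] /=.
      rewrite (max_l (x0 a)); under eq_bigr do rewrite clamp_split.
      by rewrite [Num.max (_ + _) 0](max_l (y0 a)) max_l.
    rewrite /halves mul1r /=; congr (Num.max (_ + _) 0).
    have /= := clamp_split 1 (cell_slope (w ki.1) ki.2)
      (cell_shift (w ki.1) ki.2) (x (inr ki.1)).
    rewrite !mulr1 => ->; rewrite max_l//.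
    by have /andP[] := v01 ki.
  rewrite iter_saw_layer// merge_layerE.
  apply/funext => -[a|ki] /=.
    rewrite big1 ?mulr0 ?addr0 ?max_l// => k _.
    by rewrite !mul0r addr0.
  rewrite saw_halves /= -iterS prednK// max_l//.
  by have /andP[] := iter_saw01 s (v01 ki).
split=> //= a; rewrite /y -addrA; congr (_ + _).
have [->|ac] := eqVneq a c.
  by rewrite ltnn leqnn subnn mul1r addr0 pair_bigA.
rewrite mul0r add0r; case: (ltnP c a) => ca.
  by rewrite ltnW// -(subnSK ca) /= pair_bigA.
by rewrite leqNgt ltn_neqAle ca andbT (inj_eq (@ord_inj d)) ac.
Qed.

End LevelNet.

(** Pays for carrying [r.+1] coordinates through a number of layers proportional to [r], within the
    factor [2 ^ d]. *)
Lemma mul_succ_leq_exp2 r : (r * r.+1 <= 2 ^ r.+1)%N.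
Proof.
(* Doubling dominates the growth of the left side only from [r = 2] on, where the induction
   starts. *)
case: r => [//|]; case=> [//|]; elim=> [//|r ih].
by rewrite expnS; lia.
Qed.

(** With [E = 2 ^ r.+1] and [X = n ^ r], the four summands are at most [4 * E * s * X],
    [16 * E * s * X], [2 * E * n * X] and [6 * E * n * X]. The totals 20 and 8 are both below 22. *)
Lemma level_net_size r n s : (0 < n)%N -> (0 < s)%N ->
  (r * (s + 3) * r.+1 + r * (10 + 6 * s) * n ^ r + 2 * r.+1 + 6 * n ^ r.+1
   <= 22 * 2 ^ r.+1 * (n ^ r.+1 + n ^ r * s))%N.
Proof.
move=> n0 s0; rewrite expnS.
have X0 : (0 < n ^ r)%N by rewrite expn_gt0 n0.
have rE := mul_succ_leq_exp2 r.
have rE' : (r.+1 <= 2 ^ r.+1)%N by rewrite ltnW// ltn_expl.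
move: (n ^ r)%N (2 ^ r.+1)%N X0 rE rE' => X E X0 rE rE'.
have h1 : (r * (s + 3) * r.+1 <= E * (4 * s) * X)%N.
  rewrite mulnAC (leq_trans (leq_mul rE (_ : s + 3 <= 4 * s)%N))//;
    first by lia.
  exact: leq_pmulr.
have h2 : (r * (10 + 6 * s) * X <= E * (16 * s) * X)%N.
  by rewrite leq_mul// leq_mul//; lia.
have h3 : (2 * r.+1 <= 2 * E * (n * X))%N.
  by rewrite (leq_trans (leq_mul (leqnn 2) rE'))// leq_pmulr// muln_gt0 n0.
have h4 : (6 * (n * X) <= 6 * E * (n * X))%N.
  by rewrite -mulnA leq_mul// leq_pmull//; lia.
by nia.
Qed.

Lemma hist_net (R : realType) (r n s : nat) (w : @hist R n r.+1) :
  (0 < n)%N -> (0 < s)%N ->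
  exists Psi : relu_net R 1 r.+1,
    [/\ (net_conn Psi <= 22 * 2 ^ r.+1 * (n ^ r.+1 + n ^ r * s))%N,
        net_depth Psi = (r * (s + 3) + 2)%N
      & forall t, net_fun1 Psi t = \row_j hist_map s w t j].
Proof.
move=> n0 s0.
have [N [NC ND NF]] := level_net (fun _ : unit => w) (c := ord0) n0 s0 erefl.
(* Only the signal is kept as input; the output coordinates start at 0, which meets the
   nonnegativity condition. *)
have [N' [NC' ND' NF']] := net_restrict_input N (enum_rank (inr tt)).
exists N'; split.
- rewrite (leq_trans NC')// (leq_trans NC)// card_unit !muln1.
  exact: level_net_size.
- by rewrite ND' ND.
move=> t; pose x := state (fun _ : 'I_r.+1 => 0) (fun _ : unit => t).
rewrite /net_fun1 NF' (_ : t *: _ = vec x) ?NF//.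
  by apply/rowP => j; rewrite !mxE /= add0r subn0 big_const card_unit /= addr0.
apply/rowP => i; rewrite !mxE -(inj_eq enum_val_inj) enum_rankK.
case: (enum_val i) => [a|[]] /=; last by rewrite mulr1.
by rewrite mulr0.
Qed.

(** * Measurability and integration over [Rd] *)

Section RdMeasurability.
Context {R : realType}.
Local Notation mR := (measurableTypeR R).

Lemma measurable_coord r (j : 'I_r) :
  measurable_fun [set: Rd R r] (fun v : Rd R r => (v : 'rV[R]_r) ord0 j : mR).
Proof.
apply: (measurability _ (RGenOInfty.measurableE R)) => _ [_ [x ->] <-].
rewrite setTI; apply: sub_sigma_algebra.
apply: (open_comp (f := fun v : 'rV[R]_r => v ord0 j));
  last exact: interval_open.
by move=> v _; exact: coord_continuous.
Qed.

(** Sup-norm balls with rational centres and radii [1 / (m + 1)]: a countable base, through which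
    coordinatewise measurability yields measurability into the sigma-algebra generated by the open
    sets. *)
Definition rat_box r (qm : {ffun 'I_r -> rat} * nat) : set 'rV[R]_r :=
  [set v | forall j, `|v ord0 j - ratr (qm.1 j)| < qm.2.+1%:R^-1].

Lemma open_rat_box r (U : set 'rV[R]_r) : open U ->
  U = \bigcup_(qm in [set qm | rat_box qm `<=` U]) rat_box qm.
Proof.
move=> oU; apply/seteqP; split=> [v Uv|v [qm qmU]]; last exact: qmU.
have /nbhs_ballP[e /= e0 eU] : nbhs v U by exact: open_nbhs_nbhs.
have [m _ me] : exists2 m, (0 <= m)%N & m.+1%:R^-1 < e / 2.
  have := near_infty_natSinv_lt (PosNum (divr_gt0 e0 (ltr0n R 2))).
  by case=> m _ /(_ m (leqnn m)) /= h; exists m.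
have q_ex j : exists q : rat, `|v ord0 j - ratr q| < m.+1%:R^-1.
  have /rat_in_itvoo[q] : v ord0 j - m.+1%:R^-1 < v ord0 j + m.+1%:R^-1.
    by rewrite ltrBlDr -addrA ltrDl addr_gt0// invr_gt0.
  by rewrite in_itv/= => /andP[h1 h2]; exists q; rewrite ltr_distlC h1 h2.
have [q qP] := choice q_ex.
exists ([ffun j => q j], m) => [u /= bu|j /=]; last by rewrite ffunE.
apply: eU; split=> // i j; rewrite (ord1 i) /ball /=.
rewrite (le_lt_trans (ler_distD (ratr (q j)) _ _))// [ltRHS](splitr e) ltrD//.
  exact: lt_trans (qP j) me.
by have := bu j; rewrite ffunE distrC => /lt_trans -> //.
Qed.

Lemma measurable_fun_Rd dT (T : measurableType dT) r (f : T -> Rd R r) :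
  (forall j, measurable_fun [set: T] (fun x => (f x : 'rV[R]_r) ord0 j : mR)) ->
  measurable_fun [set: T] f.
Proof.
move=> mf; apply: (@measurability _ _ T (Rd R r) _ _ (open : set (set
  'rV[R]_r)) erefl).
move=> _ [U oU <-]; rewrite setTI (open_rat_box oU) preimage_bigcup.
rewrite bigcup_mkcond; apply: countable_bigcupT_measurable => // qm.
case: ifPn => // _.
rewrite (_ : _ @^-1` _ = \bigcap_(j in [set: 'I_r])
    (fun x => (f x : 'rV[R]_r) ord0 j) @^-1`
      [set t | `|t - ratr (qm.1 j)| < qm.2.+1%:R^-1]); last first.
  by apply/seteqP; split=> [x h j _|x h j]; exact: h.
apply: fin_bigcap_measurable => // j _.
rewrite -[X in measurable X]setTI; apply: mf => //.
rewrite (_ : [set t | _] =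
  `]ratr (qm.1 j) - qm.2.+1%:R^-1, ratr (qm.1 j) + qm.2.+1%:R^-1[%classic)//.
by apply/seteqP; split=> t /=; rewrite in_itv /= ltr_distl.
Qed.

Definition cons_row r (t : R) (v : 'rV[R]_r) : 'rV[R]_r.+1 :=
  row_mx (const_mx t : 'rV[R]_1) v.

Lemma cons_row0 r t (v : 'rV[R]_r) : cons_row t v ord0 ord0 = t.
Proof.
by rewrite mxE; case: splitP => [j' _|j' /= j'0]; [rewrite mxE|].
Qed.

Lemma cons_rowS r t (v : 'rV[R]_r) j :
  cons_row t v ord0 (lift ord0 j) = v ord0 j.
Proof.
rewrite mxE; case: splitP => [[[]]//|k /= jk]; congr (v _ _).
by apply: val_inj; move: jk => [].
Qed.

Lemma measurable_cons_row dT (T : measurableType dT) r (f : T -> mR)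
    (g : T -> Rd R r) :
  measurable_fun [set: T] f -> measurable_fun [set: T] g ->
  measurable_fun [set: T] (fun x => cons_row (f x) (g x) : Rd R r.+1).
Proof.
move=> mf mg; apply: measurable_fun_Rd => j.
case: (unliftP ord0 j) => [j'|] ->.
  under eq_fun do rewrite cons_rowS.
  exact: measurableT_comp (measurable_coord j') mg.
by under eq_fun do rewrite cons_row0.
Qed.

End RdMeasurability.

Section LebesgueInt.
Context {R : realType}.
Local Notation mR := (measurableTypeR R).
Local Notation mu := (@lebesgue_measure R).
Local Open Scope ereal_scope.

Lemma lebesgue_int_ge0 r (f : 'rV[R]_r -> \bar R) :
  (forall v, 0 <= f v) -> 0 <= lebesgue_int f.
Proof.
elim: r f => [|r ih] f f0 /=; first exact: f0.
by apply: integral_ge0 => t _; exact: ih.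
Qed.

(** The parameter space varies in the induction: peeling off a coordinate moves it into the
    parameter, from which Tonelli integrates it out. *)
Lemma measurable_lebesgue_int r dX (X : measurableType dX)
    (f : X * Rd R r -> \bar R) :
  measurable_fun [set: X * Rd R r] f -> (forall z, 0 <= f z) ->
  measurable_fun [set: X] (fun x => lebesgue_int (fun v => f (x, v))).
Proof.
elim: r dX X f => [|r ih] dX X f mf f0 /=.
  apply: (measurableT_comp mf); exact: measurable_fun_pair.
pose g (z : (X * mR) * Rd R r) := f (z.1.1, cons_row z.1.2 z.2).
have mg : measurable_fun [set: (X * mR) * Rd R r] g.
  apply: (measurableT_comp mf); apply: measurable_fun_pair.
    exact: measurableT_comp measurable_fst measurable_fst.
  apply: measurable_cons_row => //.
  exact: measurableT_comp measurable_snd measurable_fst.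
have h0 (z : X * mR) : 0 <= lebesgue_int (fun v => g (z, v)).
  by apply: lebesgue_int_ge0 => v; exact: f0.
have mh := ih _ _ g mg (fun z => f0 _).
exact: (measurable_fun_fubini_tonelli_F (m2 := mu) _ mh h0).
Qed.

Lemma measurable_fun_cons_row r (f : Rd R r.+1 -> \bar R) :
  measurable_fun [set: Rd R r.+1] f ->
  measurable_fun [set: mR * Rd R r] (fun z => f (cons_row z.1 z.2)).
Proof.
by move=> mf; apply: (measurableT_comp mf); exact: measurable_cons_row.
Qed.

Lemma lebesgue_int_sumZ r (I : finType) (c : I -> R) (f : I -> Rd R r -> \bar
  R) :
  (forall i, (0 <= c i)%R) -> (forall i, measurable_fun [set: Rd R r] (f i)) ->
  (forall i v, 0 <= f i v) ->
  lebesgue_int (fun v => \sum_i (c i)%:E * f i v) =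
  \sum_i (c i)%:E * lebesgue_int (f i).
Proof.
elim: r f => [//|r ih] f c0 mf f0 /=.
have mf' i := measurable_fun_cons_row (mf i).
have mg i : measurable_fun [set: mR]
    (fun t : mR => lebesgue_int (fun v => f i (cons_row t v))).
  exact: measurable_lebesgue_int (mf' i) _.
have g0 i t : 0 <= lebesgue_int (fun v => f i (cons_row t v)).
  exact: lebesgue_int_ge0.
under eq_integral => t _.
  rewrite (ih (fun i v => f i (cons_row t v)))//; last first.
    by move=> i; exact: (measurableT_comp (mf' i) (pair1_measurable t)).
  over.
rewrite ge0_integral_sum//.
- by apply: eq_bigr => i _; rewrite ge0_integralZl//; rewrite lee_fin.
- by move=> i; apply: measurable_funeM; exact: mg.
- by move=> i t _; rewrite mule_ge0// lee_fin.
Qed.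

End LebesgueInt.

(** * Uniform variables along inverse branches *)

Section Uniform.
Context {R : realType}.
Local Notation mR := (measurableTypeR R).
Local Notation mu := (@lebesgue_measure R).
Local Open Scope ereal_scope.

Definition unif : probability mR R := uniform_prob (@ltr01 R).

Lemma integral_unif (f : mR -> \bar R) :
  measurable_fun [set: mR] f -> (forall t, 0 <= f t) ->
  \int[unif]_t f t = \int[mu]_(t in `[0%R, 1%R]) f t.
Proof. by move=> mf f0; rewrite integral_uniform// subr0 invr1 mul1e. Qed.

Lemma unifE (A : set mR) : measurable A -> unif A = mu (`[0%R, 1%R] `&` A).
Proof.
move=> mA; rewrite -{1}[A]setIT -integral_indic// integral_unif//; last first.
  exact/measurable_EFinP/measurable_indic.
by rewrite integral_indic// setIC.
Qed.

Definition affine_map (a c t : R) : R := (a + c * t)%R.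

Lemma measurable_affine_map a c : measurable_fun [set: mR] (affine_map a c :
  mR -> mR).
Proof. by apply: measurable_funD => //; exact: measurable_funM. Qed.

(** Lebesgue measure is determined by its values on half-open intervals, so the identity reduces to
    lengths. *)
Lemma lebesgue_measure_affine a c (A : set mR) : (c != 0)%R -> measurable A ->
  mu A = `|c|%:E * mu (affine_map a c @^-1` A).
Proof.
move=> c0 mA.
pose m' : {measure set mR -> \bar R} :=
  pushforward mu (affine_map a c : mR -> mR).
pose m := m' (measurable_affine_map a c).
pose cn := NngNum (normr_ge0 c).
suff : mu A = mscale cn m A by [].
apply: lebesgue_measure_unique => // _ [[x y] _ <-].
rewrite -[RHS]/(`|c|%:E * mu (affine_map a c @^-1` `]x, y]%classic)).
rewrite lebesgue_measure_itv/= lte_fin.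
have [xy|yx] := ltP x y; last first.
  rewrite (_ : _ @^-1` _ = set0) ?measure0 ?mule0//.
  rewrite -subset0 => t /=; rewrite in_itv/= => /andP[h1 h2].
  by move: (lt_le_trans h1 h2); rewrite ltNge yx.
(* A negative slope, needed for the decreasing branch of the sawtooth, swaps the open and the closed
   end. *)
have [cn0|cp0] := ltP c 0%R.
  rewrite (_ : _ @^-1` _ = `[((y - a) / c)%R, ((x - a) / c)%R[%classic).
    rewrite lebesgue_measure_itv/= lte_fin ltr_ndivrMr// divfK// ltrD2r xy.
    rewrite -EFinB -EFinM ltr0_norm//; congr EFin; field.
    exact: c0.
  apply/seteqP; split=> t /=; rewrite !in_itv/= /affine_map.
    by rewrite ler_ndivrMr// ltr_ndivlMr//; lra.
  by rewrite ler_ndivrMr// ltr_ndivlMr//; lra.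
have {cp0} c0' : (0 < c)%R by rewrite lt_def c0.
rewrite (_ : _ @^-1` _ = `]((x - a) / c)%R, ((y - a) / c)%R]%classic).
  rewrite lebesgue_measure_itv/= lte_fin ltr_pdivrMr// divfK// ltrD2r xy.
  rewrite -EFinB -EFinM gtr0_norm//; congr EFin; field.
  exact: c0.
apply/seteqP; split=> t /=; rewrite !in_itv/= /affine_map.
  by rewrite ltr_pdivrMr// ler_pdivlMr//; lra.
by rewrite ltr_pdivrMr// ler_pdivlMr//; lra.
Qed.

Lemma integral_affine a c (D : set mR) (f : mR -> \bar R) :
  (c != 0)%R -> measurable D -> measurable_fun [set: mR] f ->
  (forall t, 0 <= f t) ->
  \int[mu]_(t in D) f t =
  `|c|%:E * \int[mu]_(t in affine_map a c @^-1` D) f (affine_map a c t).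
Proof.
move=> c0 mD mf f0.
pose m' : {measure set mR -> \bar R} :=
  pushforward mu (affine_map a c : mR -> mR).
pose m := m' (measurable_affine_map a c).
pose cn := NngNum (normr_ge0 c).
rewrite (eq_measure_integral (mscale cn m)); last first.
  move=> A mA _; exact: (lebesgue_measure_affine a c0 mA).
rewrite ge0_integral_mscale//; last exact: measurable_funTS.
rewrite ge0_integral_pushforward//; first exact: measurable_affine_map.
exact: measurable_funTS.
Qed.

Lemma integral_itv_unif a c (f : mR -> \bar R) : (0 < c)%R ->
  measurable_fun [set: mR] f -> (forall t, 0 <= f t) ->
  \int[mu]_(t in `[a, (a + c)%R]) f t =
  c%:E * \int[unif]_t f (affine_map a c t).
Proof.
move=> c0 mf f0; rewrite (@integral_affine a c)// ?gt_eqF// gtr0_norm//.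
rewrite integral_unif//; last first.
  by apply: (measurableT_comp mf); exact: measurable_affine_map.
congr (_ * _); congr (integral _ _ _).
by apply/seteqP; split=> t /=;
  rewrite !in_itv/= /affine_map lerDl lerD2l pmulr_rge0// ger_pMr.
Qed.

Lemma integral_itv_unifN a c (f : mR -> \bar R) : (0 < c)%R ->
  measurable_fun [set: mR] f -> (forall t, 0 <= f t) ->
  \int[mu]_(t in `[(a - c)%R, a]) f t =
  c%:E * \int[unif]_t f (affine_map a (- c)%R t).
Proof.
move=> c0 mf f0; rewrite (@integral_affine a (- c)%R)// ?oppr_eq0 ?gt_eqF//.
rewrite normrN gtr0_norm// integral_unif//; last first.
  by apply: (measurableT_comp mf); exact: measurable_affine_map.
congr (_ * _); congr (integral _ _ _).
by apply/seteqP; split=> t /=; rewrite !in_itv/= /affine_map mulNr;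
  rewrite lerD2l gerDl lerN2 oppr_le0 pmulr_rge0// ger_pMr// andbC.
Qed.

Lemma integral_itv_split a b c (f : mR -> \bar R) : (a <= b <= c)%R ->
  measurable_fun [set: mR] f -> (forall t, 0 <= f t) ->
  \int[mu]_(t in `[a, c]) f t =
  \int[mu]_(t in `[a, b]) f t + \int[mu]_(t in `[b, c]) f t.
Proof.
move=> /andP[ab bc] mf f0.
have -> : `[a, c]%classic = `[a, b[%classic `|` `[b, c]%classic :> set R.
  apply/seteqP; split=> t /=; rewrite !in_itv/=.
    by move=> /andP[-> ->]; case: ltP => _; [left|right].
  by move=> [/andP[-> /ltW /le_trans->]|/andP[/(le_trans ab)-> ->]].
rewrite ge0_integral_setU//.
- by rewrite integral_itv_bndo_bndc//; exact: measurable_funTS.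
- exact: measurable_funTS.
- rewrite disj_set2E; apply/eqP; rewrite -subset0 => t [] /=.
  by rewrite !in_itv/= => /andP[_ tb] /andP[bt _]; move: tb; rewrite ltNge bt.
Qed.

(* The two inverse branches of [saw] on [[0, 1]]. *)
Definition fold_branch (b : bool) : R -> R :=
  if b then affine_map 1 (- 2^-1)%R else affine_map 0 2^-1.

(** The recursive product lets a sum over foldings split along the outermost branch. *)
Fixpoint bits (s : nat) : finType :=
  if s is s'.+1 then (bool * bits s')%type else unit.

Fixpoint folds s : bits s -> R -> R :=
  match s with
  | 0 => fun _ t => t
  | s'.+1 => fun l t => fold_branch l.1 (@folds s' l.2 t)
  end.

Lemma measurable_fold_branch b :
  measurable_fun [set: mR] (fold_branch b : mR -> mR).
Proof. by case: b; exact: measurable_affine_map. Qed.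

Lemma measurable_folds s (l : bits s) :
  measurable_fun [set: mR] (folds l : mR -> mR).
Proof.
elim: s l => [_|s ih [b l]] /=; first exact: measurable_id.
exact: (measurableT_comp (measurable_fold_branch b) (ih l)).
Qed.

Lemma integral_unif_fold_branch (f : mR -> \bar R) :
  measurable_fun [set: mR] f -> (forall t, 0 <= f t) ->
  \int[unif]_t f t = \sum_b (2^-1%R)%:E * \int[unif]_t f (fold_branch b t).
Proof.
move=> mf f0; rewrite integral_unif// (@integral_itv_split _ 2^-1%R)//;
  last first.
  by apply/andP; split; lra.
rewrite big_bool /= addeC -[in `[0%R, _]](add0r 2^-1%R) integral_itv_unif//.
rewrite [X in `[X, 1%R]](_ : _ = 1 - 2^-1)%R; last by lra.
by rewrite integral_itv_unifN.
Qed.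

Lemma integral_unif_folds s (f : mR -> \bar R) :
  measurable_fun [set: mR] f -> (forall t, 0 <= f t) ->
  \int[unif]_t f t = \sum_(l : bits s) ((2^-1) ^+ s)%:E * \int[unif]_t f
    (folds l t).
Proof.
elim: s f => [|s ih] f mf f0.
  by rewrite (big_pred1 tt) ?mul1e//; case.
rewrite integral_unif_fold_branch//.
rewrite -(pair_bigA _ (fun b l => ((2^-1) ^+ s.+1)%:E *
  \int[unif]_t f (folds (s := s.+1) (b, l) t))) /=.
apply: eq_bigr => b _.
rewrite (ih _ (measurableT_comp mf (measurable_fold_branch b)) (fun=> f0 _)).
rewrite ge0_sume_distrr.
  by apply: eq_bigr => l _; rewrite muleA -EFinM -exprS.
move=> l _; apply: mule_ge0; first by rewrite lee_fin exprn_ge0// invr_ge0.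
by apply: integral_ge0 => t _; exact: f0.
Qed.

Lemma folds01 s (l : bits s) t : (0 <= t <= 1)%R -> (0 <= folds l t <= 1)%R.
Proof.
move=> t01; elim: s l => [//|s ih [b l]] /=; have := ih l.
by case: b; rewrite /= /affine_map; lra.
Qed.

(** A folding is affine with slope [2 ^ -s] up to sign. This is the source of the accuracy of the
    approximation. *)
Lemma folds_contract s (l : bits s) t u : (0 <= t <= 1)%R -> (0 <= u <= 1)%R ->
  (`|folds l t - folds l u| <= (2^-1) ^+ s)%R.
Proof.
move=> t01 u01; elim: s l => [_|s ih] /=; first by rewrite expr0 ler_norml; lra.
move=> [b l]; rewrite exprS /=; have := ih l.
by case: b => /=; rewrite /affine_map !ler_norml; lra.
Qed.

(** Each branch is a right inverse of [saw] on [[0, 1]], and the head bit is the outermost branch,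
    so it is undone first. *)
Lemma iter_saw_folds s (l : bits s) t : (0 <= t <= 1)%R ->
  iter s saw (folds l t) = t.
Proof.
move=> t01; elim: s l => [//|s ih [b l]]; rewrite iterSr -[RHS](ih l).
congr iter; have := folds01 l t01; case: b => /=;
  rewrite /affine_map /saw /Num.max; case: ifP; case: ifP; lra.
Qed.

Definition cum n (m : 'I_n -> R) (k : nat) : R := (\sum_(i < n | (i < k)%N) m
  i)%R.

Lemma cumS n (m : 'I_n -> R) (i : 'I_n) : cum m i.+1 = (cum m i + m i)%R.
Proof.
rewrite /cum (bigD1 i)//= addrC; congr (_ + _)%R; apply: eq_bigl => j.
by rewrite ltnS [RHS]ltn_neqAle andbC.
Qed.

Lemma integral_unif_cells n (m : 'I_n -> R) (f : mR -> \bar R) :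
  (forall i, 0 < m i)%R -> (\sum_i m i = 1)%R ->
  measurable_fun [set: mR] f -> (forall t, 0 <= f t) ->
  \int[unif]_t f t =
  \sum_i (m i)%:E * \int[unif]_t f (affine_map (cum m i) (m i) t).
Proof.
move=> m0 m1 mf f0.
(* Generalized to the initial segment [[0, cum m k]], so that each induction step adds one cell. *)
suff H k : (k <= n)%N -> \int[mu]_(t in `[0%R, cum m k]) f t =
    \sum_(i < n | (i < k)%N) (m i)%:E * \int[unif]_t f (affine_map (cum m i)
      (m i) t).
  rewrite integral_unif// -[in `[_, 1%R]]m1.
  rewrite (_ : (\sum_i m i)%R = cum m n); last by apply: eq_bigl => i;
    rewrite ltn_ord.
  by rewrite H//; apply: eq_bigl => i; rewrite ltn_ord.
elim: k => [_|k ih kn].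
  by rewrite /cum !big_pred0// set_itv1 integral_set1.
have c0 : (0 <= cum m k)%R by apply: sumr_ge0 => i _; exact: ltW.
pose i := Ordinal kn; rewrite (@integral_itv_split _ (cum m k))//; last first.
  by rewrite c0 (cumS m i) lerDl ltW.
rewrite ih; last exact: ltnW.
rewrite (cumS m i) integral_itv_unif// [RHS](bigD1 i)//= addeC.
by congr (_ + _); apply: eq_bigl => j; rewrite ltnS [LHS]ltn_neqAle andbC.
Qed.

End Uniform.

Lemma mixture_probability (R : realType) dT (T : measurableType dT) (I :
  finType)
    (c : I -> R) (P : I -> probability T R) :
  (forall i, 0 <= c i) -> \sum_i c i = 1 ->
  exists Q : probability T R,
    forall A, Q A = (\sum_i (c i)%:E * P i A)%E.
Proof.
move=> c0 c1.
(* [msum] takes a family over the natural numbers, so [I] is enumerated; [mzero] fills the indices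
   outside the range of the sum. *)
pose m (k : nat) : {measure set T -> \bar R} :=
  if (insub k : option 'I_#|I|) is Some j then
    mscale (NngNum (c0 (@enum_val I predT j))) (P (@enum_val I predT j))
  else mzero.
have mE A : msum m #|I| A = (\sum_i (c i)%:E * P i A)%E.
  rewrite [RHS](reindex (@enum_val I predT)) /=;
    last exact/onW_bij/enum_val_bij.
  by apply: eq_bigr => j _; rewrite /m valK.
have m1 : msum m #|I| [set: T] = 1%E.
  rewrite mE; under eq_bigr do rewrite probability_setT mule1.
  by rewrite sumEFin c1.
pose Q : probability T R :=
  HB.pack (msum m #|I|) (Measure_isProbability.Build _ _ _ (msum m #|I|) m1).
by exists Q.
Qed.

(** * The histogram map along the inverse branches *)

Section HistMap.
Context {R : realType} {n : nat}.
Local Notation hist := (@hist R n).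

Lemma saw0 : saw 0 = 0 :> R.
Proof. by rewrite /saw /Num.max; case: ifP; case: ifP; lra. Qed.

Lemma saw1 : saw 1 = 0 :> R.
Proof. by rewrite /saw /Num.max; case: ifP; case: ifP; lra. Qed.

Lemma iter_saw0 s : iter s saw 0 = 0 :> R.
Proof. by elim: s => //= s ->; exact: saw0. Qed.

Lemma iter_saw1 s : (0 < s)%N -> iter s saw 1 = 0 :> R.
Proof. by case: s => // s _; rewrite iterSr saw1 iter_saw0. Qed.

Lemma total_gt0 r (w : hist r) : (0 < n)%N -> (forall k, 0 < w k) -> 0 < total
  w.
Proof.
move=> n0 w0; rewrite /total (bigD1 [ffun=> Ordinal n0])//=.
by rewrite ltr_wpDr// sumr_ge0// => k _; exact: ltW.
Qed.

Definition marginal r (w : hist r.+1) (i : 'I_n) : R :=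
  total (subhist w i) / total w.

Lemma marginal_gt0 r (w : hist r.+1) i : (0 < n)%N -> (forall k, 0 < w k) ->
  0 < marginal w i.
Proof. by move=> n0 w0; rewrite divr_gt0// total_gt0// => k; exact: w0. Qed.

Lemma sum_marginal r (w : hist r.+1) : (0 < n)%N -> (forall k, 0 < w k) ->
  \sum_i marginal w i = 1.
Proof.
move=> n0 w0; rewrite -mulr_suml -total_subhist divff// gt_eqF//.
exact: total_gt0.
Qed.

Lemma cum_le (m : 'I_n -> R) (k l : nat) : (forall i, 0 < m i) -> (k <= l)%N ->
  cum m k <= cum m l.
Proof.
move=> m0 kl; rewrite /cum [leRHS](bigID (fun i : 'I_n => (i < k)%N)) /=.
rewrite ler_wpDr ?sumr_ge0//; first by move=> i _; exact: ltW.
rewrite (eq_bigl (fun i : 'I_n => (i < l)%N && (i < k)%N))// => i.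
by case: (ltnP i k) => ik; rewrite ?andbF// (leq_trans ik kl).
Qed.

Lemma cum_ge0 (m : 'I_n -> R) (k : nat) : (forall i, 0 < m i) -> 0 <= cum m k.
Proof. by move=> m0; apply: sumr_ge0 => i _; exact: ltW. Qed.

Lemma cell_posE r (w : hist r.+1) i u : (0 < n)%N -> (forall k, 0 < w k) ->
  cell_pos w i u = clamp 1 0 ((u - cum (marginal w) i) / marginal w i).
Proof.
move=> n0 w0; rewrite /cell_pos /clamp /cell_slope /cell_shift.
have -> : cum (marginal w) i =
    (\sum_(i' < n | (i' < i)%N) total (subhist w i')) / total w.
  by rewrite /cum -mulr_suml.
have t0 : total w != 0 by rewrite gt_eqF// total_gt0.
have ti0 : total (subhist w i) != 0.
  by rewrite gt_eqF// total_gt0// => k; exact: w0.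
set S := \sum_(_ < _ | _) _.
suff -> : total w / total (subhist w i) * u + - (S / total (subhist w i)) =
    1 * ((u - S / total w) / marginal w i) + 0 by [].
by rewrite /marginal; field; rewrite t0.
Qed.

Lemma clamp_le0 (x : R) : x <= 0 -> clamp 1 0 x = 0.
Proof. by rewrite /clamp /Num.max; case: ifP; case: ifP; lra. Qed.

Lemma clamp_ge1 (x : R) : 1 <= x -> clamp 1 0 x = 1.
Proof. by rewrite /clamp /Num.max; case: ifP; case: ifP; lra. Qed.

Lemma clamp_id (x : R) : 0 <= x <= 1 -> clamp 1 0 x = x.
Proof. by rewrite /clamp /Num.max; case: ifP; case: ifP; lra. Qed.

(** As the partial sums increase, an input in cell [i] saturates the clamps of earlier cells at 1
    and those of later cells at 0. *)
Lemma cell_pos_affine r (w : hist r.+1) (i i' : 'I_n) v :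
  (0 < n)%N -> (forall k, 0 < w k) -> 0 <= v <= 1 ->
  cell_pos w i' (affine_map (cum (marginal w) i) (marginal w i) v) =
  if i' == i then v else (i' < i)%:R.
Proof.
move=> n0 w0 /andP[v0 v1]; rewrite cell_posE//.
have m0 := marginal_gt0 _ n0 w0; rewrite /affine_map.
have [->|ii'] := eqVneq i' i.
  rewrite addrAC subrr add0r mulrAC divff ?gt_eqF// mul1r clamp_id//.
  by rewrite v0.
case: ltnP => i'i.
  rewrite clamp_ge1// ler_pdivlMr// mul1r lerBrDl -cumS.
  by rewrite (le_trans (cum_le m0 i'i))// lerDl mulr_ge0// ltW.
rewrite clamp_le0// pmulr_lle0 ?invr_gt0// subr_le0.
have {}i'i : (i < i')%N by rewrite ltn_neqAle i'i andbT eq_sym -(inj_eq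
  (@ord_inj n)) in ii' *.
by rewrite (le_trans _ (cum_le m0 i'i))// cumS lerD2l ler_piMr// ltW.
Qed.

Lemma hist_map0 s r (w : hist r) j : (0 < n)%N -> (forall k, 0 < w k) ->
  hist_map s w 0 j = 0.
Proof.
move=> n0; elim: r w j => [//|r ih] w j w0.
have c0 i : cell_pos w i 0 = 0.
  rewrite cell_posE// clamp_le0// pmulr_lle0 ?invr_gt0 ?marginal_gt0//.
  by rewrite sub0r oppr_le0 cum_ge0// => k; exact: marginal_gt0.
case: j => [|j] /=; apply: big1 => i _; rewrite c0 ?mul0r//.
by rewrite iter_saw0 ih// => k; exact: w0.
Qed.

(** The [i] saturated cells contribute [1 / n] each, which places the output in the right cell of
    the grid. *)
Lemma hist_map_branch0 s r (w : hist r.+1) (i : 'I_n) v :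
  (0 < n)%N -> (forall k, 0 < w k) -> 0 <= v <= 1 ->
  hist_map s w (affine_map (cum (marginal w) i) (marginal w i) v) 0 =
  affine_map (i%:R / n%:R) n%:R^-1 v.
Proof.
move=> n0 w0 v01 /=; rewrite -mulr_suml /affine_map.
under eq_bigr do rewrite cell_pos_affine//.
rewrite (bigD1 i)//= eqxx mulrDl addrC [n%:R^-1 * v]mulrC; congr (_ * _ + _).
rewrite (eq_bigr (fun j : 'I_n => (j < i)%:R)) => [|j /negbTE->//].
rewrite -natr_sum; congr _%:R.
rewrite -[RHS](card_ord i) -sum1_card.
rewrite (big_ord_widen_cond n xpredT (fun=> 1%N)) /=; last exact: ltnW.
rewrite [LHS]big_mkcond [RHS]big_mkcond /=; apply: eq_bigr => j _.
by case: eqVneq => [->|_]; [rewrite ltnn|case: (j < i)%N].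
Qed.

(** Only cell [i] passes a signal on: the other positions are 0 or 1, and both are sent to 0 by the
    sawtooth. For the value 1 this requires [0 < s]. *)
Lemma hist_map_branchS s r (w : hist r.+1) (i : 'I_n) (l : bits s) t j :
  (0 < n)%N -> (0 < s)%N -> (forall k, 0 < w k) -> 0 <= t <= 1 ->
  hist_map s w (affine_map (cum (marginal w) i) (marginal w i) (folds l t))
    j.+1 =
  hist_map s (subhist w i) t j.
Proof.
move=> n0 s0 w0 t01 /=; rewrite (bigD1 i)//= cell_pos_affine ?folds01//.
rewrite eqxx iter_saw_folds// big1 ?addr0// => i' /negbTE i'i.
rewrite cell_pos_affine ?folds01// i'i.
rewrite (_ : iter s saw _ = 0) ?hist_map0//; last first.
  by case: (i' < i)%N; [exact: iter_saw1|exact: iter_saw0].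
by move=> k; exact: w0.
Qed.

End HistMap.

(** * Slicing the density along its first coordinate *)

Section Density.
Context {R : realType} {n : nat}.
Local Notation mR := (measurableTypeR R).
Local Notation mu := (@lebesgue_measure R).
Local Notation hist := (@hist R n).

Definition cell (i : 'I_n) : set R := `[i%:R / n%:R, i.+1%:R / n%:R]%classic.

Lemma in_cube_cons_row r i (k : {ffun 'I_r -> 'I_n}) t (v : 'rV[R]_r) :
  in_cube (ffcons i k) (cons_row t v) = (t \in cell i) && in_cube k v.
Proof.
rewrite (_ : t \in cell i = (i%:R / n%:R <= t <= i.+1%:R / n%:R)); last first.
  by apply/idP/idP; rewrite inE /cell /= in_itv.
apply/forallP/andP => [h|[h0 /forallP h] j].
  split; first by have := h ord0; rewrite ffunE unlift_none cons_row0.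
  by apply/forallP => j; have := h (lift ord0 j); rewrite ffunE liftK cons_rowS.
rewrite ffunE; case: unliftP => [j'|] ->; first by rewrite cons_rowS.
by rewrite cons_row0.
Qed.

(** Closed cubes overlap on their faces. The indicators of closed cells count such points with the
    same multiplicity, so the identity is pointwise and not merely almost everywhere. *)
Lemma pw_density_cons_row r (w : hist r.+1) t (v : 'rV[R]_r) :
  pw_density w (cons_row t v) =
  \sum_i \1_(cell i) t * pw_density (subhist w i) v.
Proof.
rewrite /pw_density sum_ffcons; apply: eq_bigr => i _.
rewrite big_distrr /=; apply: eq_bigr => k _.
rewrite in_cube_cons_row indicE /subhist.
by case: (_ \in _); rewrite ?mul1r// mul0r mulr0.
Qed.

Lemma pw_density_ge0 r (w : hist r) v : (forall k, 0 < w k) ->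
  0 <= pw_density w v.
Proof.
by move=> w0; apply: sumr_ge0 => k _; rewrite mulr_ge0 ?(ltW (w0 k))//;
  case: ifP.
Qed.

Lemma measurable_pw_density r (w : hist r) :
  measurable_fun [set: Rd R r] (pw_density w : Rd R r -> mR).
Proof.
elim: r w => [|r ih] w.
  rewrite (_ : pw_density w = cst (pw_density w 0));
    first exact: measurable_cst.
  by apply/funext => v; congr pw_density; apply/rowP => -[].
rewrite (_ : pw_density w = fun v => \sum_i \1_(cell i) (v ord0 ord0) *
    pw_density (subhist w i) (\row_j v ord0 (lift ord0 j))); last first.
  apply/funext => v; rewrite -pw_density_cons_row; congr pw_density.
  apply/rowP => j; case: (unliftP ord0 j) => [j'|] ->.
    by rewrite cons_rowS mxE.
  by rewrite cons_row0.
apply: measurable_sum => i; apply: measurable_funM.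
  apply: (@measurableT_comp _ _ _ _ _ _ (\1_(cell i) : mR -> mR) _
    (fun v : Rd R r.+1 => (v : 'rV[R]_r.+1) ord0 ord0)).
    by apply: measurable_indic; exact: measurable_itv.
  exact: measurable_coord.
apply: (measurableT_comp (ih (subhist w i))); apply: measurable_fun_Rd => j.
by under eq_fun do rewrite mxE; exact: measurable_coord.
Qed.

Definition slice r (B : set (Rd R r.+1)) (t : R) : set (Rd R r) :=
  [set v | B (cons_row t v)].

Lemma measurable_slices r (B : set (Rd R r.+1)) : measurable B ->
  measurable [set z : mR * Rd R r | slice B z.1 z.2].
Proof.
move=> mB; rewrite -[X in measurable X]setTI.
by apply: (measurable_cons_row measurable_fst measurable_snd).
Qed.

Lemma measurable_slice r (B : set (Rd R r.+1)) t : measurable B ->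
  measurable (slice B t).
Proof.
move=> mB; rewrite -[X in measurable X]setTI.
have mt : measurable_fun [set: Rd R r] (fun v => cons_row t v : Rd R r.+1).
  exact: (measurable_cons_row (f := cst t : Rd R r -> mR) (g := id)).
exact: mt.
Qed.

Lemma measurable_dens_slice r (w : hist r) (B : set (Rd R r.+1)) :
  (forall k, 0 < w k) -> measurable B ->
  measurable_fun [set: mR] (fun t : mR => dens_measure (pw_density w) (slice B
    t)).
Proof.
move=> w0 mB; apply: (measurable_lebesgue_int (X := mR)
  (f := fun z => (pw_density w z.2 * \1_(slice B z.1) z.2)%:E)).
  apply/measurable_EFinP; apply: measurable_funM.
    exact: (measurableT_comp (measurable_pw_density w) measurable_snd).
  rewrite (_ : (fun z => _) = \1_[set z : mR * Rd R r | slice B z.1 z.2]).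
    by apply: measurable_indic; exact: measurable_slices.
  by apply/funext => z; rewrite !indicE; congr (_%:R); apply/idP/idP;
    rewrite !inE.
by move=> z; rewrite lee_fin mulr_ge0// pw_density_ge0.
Qed.

(** Within a cell, the density of the remaining coordinates does not depend on [t]; only the slice
    of [B] does. *)
Lemma dens_measure_slices r (w : hist r.+1) (B : set (Rd R r.+1)) :
  (forall k, 0 < w k) -> measurable B ->
  (dens_measure (pw_density w) B =
   \sum_i \int[mu]_(t in cell i)
     dens_measure (pw_density (subhist w i)) (slice B t))%E.
Proof.
move=> w0 mB; rewrite /dens_measure /=.
have w0' i k : 0 < subhist w i k by exact: w0.
have dge0 i t : (0 <= dens_measure (pw_density (subhist w i)) (slice B t))%E.
  by apply: lebesgue_int_ge0 => v; rewrite lee_fin mulr_ge0// pw_density_ge0.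
transitivity (\int[mu]_t \sum_i (\1_(cell i) t)%:E *
    dens_measure (pw_density (subhist w i)) (slice B t))%E.
  apply: eq_integral => t _; rewrite -lebesgue_int_sumZ//.
  - congr lebesgue_int; apply/funext => v.
    rewrite pw_density_cons_row big_distrl /= -sumEFin; apply: eq_bigr => i _.
    by rewrite -EFinM mulrA.
  - move=> i; apply/measurable_EFinP/measurable_funM.
      exact: measurable_pw_density.
    by apply: measurable_indic; exact: measurable_slice.
  - by move=> i v; rewrite lee_fin mulr_ge0// pw_density_ge0.
rewrite ge0_integral_sum//.
- apply: eq_bigr => i _; rewrite [RHS]integral_mkcond.
  apply: eq_integral => t _; rewrite patchE indicE.
  by case: ifP => _; rewrite ?mul1e// mul0e.
- move=> i; apply: emeasurable_funM; last exact: measurable_dens_slice.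
  by apply/measurable_EFinP; apply: measurable_indic; exact: measurable_itv.
- by move=> i t _; rewrite mule_ge0// lee_fin.
Qed.

End Density.

(** * The coupling *)

Lemma pushforward_probability (R : realType) dT (T : measurableType dT)
    dT' (T' : measurableType dT') (P : probability T R) (f : T -> T') :
  measurable_fun [set: T] f ->
  exists Q : probability T' R, (forall A, Q A = P (f @^-1` A)) /\
    (forall g : T' -> \bar R, measurable_fun [set: T'] g ->
      (forall y, 0 <= g y)%E -> (\int[Q]_y g y = \int[P]_x g (f x))%E).
Proof.
move=> mf; pose X : {mfun T >-> T'} :=
  HB.pack f (isMeasurableFun.Build _ _ _ _ f mf).
exists (distribution P X); split=> // g mg g0.
by rewrite ge0_integral_distribution.
Qed.

Section Coupling.
Context {R : realType} {n s : nat}.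
Local Notation mR := (measurableTypeR R).
Local Notation hist := (@hist R n).
Local Notation del := (n%:R^-1 * 2^-1 ^+ s : R).

Lemma measurable_clamp (al be : R) :
  measurable_fun [set: mR] (clamp al be : mR -> mR).
Proof.
have m1 : measurable_fun [set: mR] (fun u : mR => al * u + be : mR).
  by apply: measurable_funD => //; exact: measurable_funM.
apply: measurable_funB; apply: measurable_maxr => //.
exact: measurable_funB.
Qed.

Lemma measurable_saw : measurable_fun [set: mR] (saw : mR -> mR).
Proof.
apply: measurable_funB; apply: measurable_funM => //;
  apply: measurable_maxr => //.
exact: measurable_funB.
Qed.

Lemma measurable_hist_map r (w : hist r) j :
  measurable_fun [set: mR] ((hist_map s w)^~ j : mR -> mR).
Proof.
elim: r w j => [|r ih] w [|j] //=; apply: measurable_sum => i.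
  by apply: measurable_funM => //; exact: measurable_clamp.
apply: (measurableT_comp (ih (subhist w i) j)).
elim: s => [|s' ihs] /=; first exact: measurable_clamp.
exact: (measurableT_comp measurable_saw ihs).
Qed.

Definition close_pairs r (w : hist r) : set (mR * Rd R r) :=
  [set z | forall j : 'I_r, `|hist_map s w z.1 j - (z.2 : 'rV[R]_r) ord0 j| <=
    del].

Lemma measurable_close_pairs r (w : hist r) : measurable (close_pairs w).
Proof.
rewrite (_ : close_pairs w = \bigcap_(j in [set: 'I_r])
    ((fun z : mR * Rd R r => `|hist_map s w z.1 j - (z.2 : 'rV[R]_r) ord0 j|)
       @^-1` [set t | t <= del])); last first.
  by apply/seteqP; split=> [z h j _|z h j]; exact: h.
apply: fin_bigcap_measurable => // j _; rewrite -[X in measurable X]setTI.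
have mf : measurable_fun [set: mR * Rd R r]
    (fun z => `|hist_map s w z.1 j - (z.2 : 'rV[R]_r) ord0 j| : mR).
  apply: measurableT_comp => //; apply: measurable_funB.
    exact: (measurableT_comp (measurable_hist_map w j) measurable_fst).
  exact: (measurableT_comp (measurable_coord j) measurable_snd).
by apply: mf => //; rewrite (_ : [set t | _] = `]-oo, del]%classic).
Qed.

(* [z.2.1] is the fresh uniform variable, [z.2.2] the target below the current
   level, and [z.1] an independent position inside the dyadic cell. *)
Definition branch_map r (w : hist r.+1) (il : 'I_n * bits s)
    (z : mR * (mR * Rd R r)) : mR * Rd R r.+1 :=
  (affine_map (cum (marginal w) il.1) (marginal w il.1) (folds il.2 z.2.1),
   cons_row (affine_map (il.1%:R / n%:R) n%:R^-1 (folds il.2 z.1)) z.2.2).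

Lemma measurable_branch_map r (w : hist r.+1) il :
  measurable_fun [set: mR * (mR * Rd R r)] (branch_map w il).
Proof.
apply: measurable_fun_pair.
  apply: (measurableT_comp (measurable_affine_map _ _)).
  apply: (measurableT_comp (measurable_folds _)).
  exact: (measurableT_comp measurable_fst measurable_snd).
apply: measurable_cons_row.
  apply: (measurableT_comp (measurable_affine_map _ _)).
  exact: (measurableT_comp (measurable_folds _) measurable_fst).
exact: (measurableT_comp measurable_snd measurable_snd).
Qed.

(** Coordinate 0 compares two points of one dyadic interval. The others inherit the bound of
    [subhist] unchanged, because the signal passed down is exactly [z.2.1]. *)
Lemma branch_map_close r (w : hist r.+1) il (z : mR * (mR * Rd R r)) :
  (0 < n)%N -> (0 < s)%N -> (forall k, 0 < w k) ->
  0 <= z.1 <= 1 -> 0 <= z.2.1 <= 1 -> close_pairs (subhist w il.1) z.2 ->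
  close_pairs w (branch_map w il z).
Proof.
move: il z => [i l] [t [u v]] n0 s0 w0 /= t01 u01 zc j.
case: (unliftP ord0 j) => [j'|] ->; rewrite /branch_map /fst /snd.
  by rewrite cons_rowS lift0 hist_map_branchS//; exact: zc.
rewrite cons_row0 hist_map_branch0 ?folds01// /affine_map.
rewrite opprD addrACA subrr add0r -mulrBr normrM gtr0_norm ?invr_gt0 ?ltr0n//.
by rewrite ler_pM2l ?invr_gt0 ?ltr0n// folds_contract.
Qed.

Definition branch_weight r (w : hist r.+1) (il : 'I_n * bits s) : R :=
  marginal w il.1 * 2^-1 ^+ s.

Lemma card_bits s' : #|bits s'| = (2 ^ s')%N.
Proof.
elim: s' => [|s' ih]; first by rewrite card_unit.
by rewrite [LHS]card_prod card_bool ih expnS.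
Qed.

Lemma sum_branch_weight r (w : hist r.+1) : (0 < n)%N -> (forall k, 0 < w k) ->
  \sum_il branch_weight w il = 1.
Proof.
move=> n0 w0; rewrite -(pair_bigA _ (fun i l => branch_weight w (i, l))) /=.
rewrite -[RHS](sum_marginal n0 w0); apply: eq_bigr => i _.
rewrite /branch_weight /= sumr_const card_bits -[_ *+ (2 ^ s)%N]mulr_natr
  -mulrA natrX.
by rewrite -exprMn mulVf ?pnatr_eq0// expr1n mulr1.
Qed.

End Coupling.

Section CouplingExists.
Context {R : realType} {n s : nat}.
Local Notation mR := (measurableTypeR R).
Local Notation hist := (@hist R n).
Local Open Scope ereal_scope.

(* The weights are not normalized; a cell has volume [n ^- r], so the density
   [pw_density w] has total mass [total w / n ^+ r]. *)
Definition hist_coupling r (w : hist r) (P : probability (mR * Rd R r)%type R)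
  :=
  [/\ forall A, measurable A -> P (fst @^-1` A) = unif A,
      forall B, measurable B -> (total w)%:E * P (snd @^-1` B) =
        (n%:R ^+ r)%:E * dens_measure (pw_density w) B
    & P (~` close_pairs (s := s) w) = 0].

(** In dimension 0 there is a single point: closeness is vacuous and the density is the constant
    [total w]. *)
Lemma hist_coupling0 (w : hist 0) : exists P, hist_coupling w P.
Proof.
have mf : measurable_fun [set: mR] (fun t : mR => (t, 0%R : Rd R 0)).
  exact: measurable_fun_pair.
have [P [PE _]] := pushforward_probability (@unif R) mf.
exists P; split=> [A mA|B mB|]; rewrite PE//; last first.
  rewrite (_ : _ @^-1` _ = set0) ?measure0//.
  by rewrite -subset0 => t /= h; apply: h => -[].
rewrite expr0 mul1e /dens_measure /= EFinM.
rewrite (_ : pw_density w 0 = total w); last first.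
  apply: eq_bigr => k _; case: ifPn; rewrite ?mulr1// => /negP[].
  by apply/forallP => -[].
congr (_ * _); rewrite indicE; have [B0|B0] := boolP (0%R \in B).
  rewrite (_ : _ @^-1` _ = setT) ?probability_setT//.
  by rewrite -subTset => t _ /=; exact: set_mem.
rewrite (_ : _ @^-1` _ = set0) ?measure0//.
by rewrite -subset0 => t /= h; move: B0; rewrite mem_set.
Qed.

Lemma unif_compl01 : unif (~` `[0%R, 1%R]%classic) = 0 :> \bar R.
Proof.
rewrite unifE; first by rewrite setICr measure0.
by apply: measurableC; exact: measurable_itv.
Qed.

Lemma branch_map_null r (w : hist r.+1) i l (P : probability (mR * Rd R
  r)%type R) :
  (0 < n)%N -> (0 < s)%N -> (forall k, 0 < w k)%R ->
  hist_coupling (subhist w i) P ->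
  (unif \x P) (branch_map (s := s) w (i, l) @^-1` ~` close_pairs (s := s) w) =
    0.
Proof.
move=> n0 s0 w0 [P1 _ P3].
pose I01 : set mR := ~` `[0%R, 1%R]%classic.
have m01 : measurable I01.
  by apply: measurableC; exact: measurable_itv.
have mc := measurableC (measurable_close_pairs (s := s) (subhist w i)).
have mf : measurable (fst @^-1` I01 : set (mR * Rd R r)).
  by rewrite -[X in measurable X]setTI; exact: (measurable_fst measurableT).
pose Q : {measure set (mR * (mR * Rd R r)) -> \bar R} := unif \x P.
rewrite -[unif \x P]/(Q : set _ -> \bar R).
apply/eqP; rewrite eq_le measure_ge0 andbT.
(* [unif] lives on the whole line, so a pair can fail for three reasons: the position or the fresh
   variable leaves [[0, 1]], or the coupling one level below fails. Each has probability 0. *)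
pose N1 : set (mR * (mR * Rd R r)) := I01 `*` setT.
pose N2 : set (mR * (mR * Rd R r)) :=
  setT `*` (fst @^-1` I01).
pose N3 : set (mR * (mR * Rd R r)) :=
  setT `*` ~` close_pairs (s := s) (subhist w i).
have mN1 : measurable N1 by exact: measurableX.
have mN2 : measurable N2 by exact: measurableX.
have mN3 : measurable N3 by exact: measurableX.
apply: (@le_trans _ _ (Q (N1 `|` N2 `|` N3))).
  apply: le_measure; rewrite ?inE.
  - rewrite -[X in measurable X]setTI; apply: measurable_branch_map => //.
    by apply: measurableC; exact: measurable_close_pairs.
  - by apply: measurableU => //; exact: measurableU.
  move=> z /= zc; apply: contrapT => /not_orP[/not_orP[h1 h2] h3]; apply: zc.
  have itvT (x : R) : ~ I01 x -> (0 <= x <= 1)%R.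
    by move=> /contrapT; rewrite /= in_itv.
  apply: branch_map_close => //=.
  - by apply: itvT => h; apply: h1.
  - by apply: itvT => h; apply: h2.
  - by apply: contrapT => h; apply: h3.
have N1_0 : Q N1 = 0.
  transitivity (unif I01 * P setT); first exact: product_measure1E.
  by rewrite unif_compl01 mul0e.
have N2_0 : Q N2 = 0.
  transitivity (unif setT * P (fst @^-1` I01)); first exact: product_measure1E.
  by rewrite P1// unif_compl01 mule0.
have N3_0 : Q N3 = 0.
  transitivity (unif setT * P (~` close_pairs (s := s) (subhist w i))).
    exact: product_measure1E.
  by rewrite P3 mule0.
have h12 : Q (N1 `|` N2) <= Q N1 + Q N2 by exact: measureU2.
have h123 : Q (N1 `|` N2 `|` N3) <= Q (N1 `|` N2) + Q N3.
  by apply: measureU2 => //; exact: measurableU.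
by rewrite (le_trans h123)// N3_0 adde0 (le_trans h12)// N1_0 N2_0 adde0.
Qed.

(** The input component ignores the position [z.1], so the preimage is a rectangle and only the
    uniform marginal of [P] enters. *)
Lemma branch_map_fst r (w : hist r.+1) i l (P : probability (mR * Rd R r)%type
  R)
    (A : set mR) : hist_coupling (subhist w i) P -> measurable A ->
  (unif \x P) (branch_map (s := s) w (i, l) @^-1` (fst @^-1` A)) =
  \int[unif]_t (\1_A (affine_map (cum (marginal w) i) (marginal w i) (folds l
    t)))%:E.
Proof.
move=> [P1 _ _] mA.
have mg : measurable_fun [set: mR]
    (fun t : mR => affine_map (cum (marginal w) i) (marginal w i) (folds l t)
      : mR).
  exact: (measurableT_comp (measurable_affine_map _ _) (measurable_folds l)).
have mA' : measurable ((fun t : mR =>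
    affine_map (cum (marginal w) i) (marginal w i) (folds l t) : mR) @^-1` A).
  by rewrite -[X in measurable X]setTI; exact: mg.
transitivity (unif [set: mR] * P (fst @^-1` ((fun t : mR =>
    affine_map (cum (marginal w) i) (marginal w i) (folds l t) : mR) @^-1` A))).
  rewrite -[RHS]product_measure1E//.
    by congr (_ _); apply/seteqP; split=> z //= [].
  by rewrite -[X in measurable X]setTI; exact: (measurable_fst measurableT).
rewrite probability_setT mul1e P1// -[in LHS](setIT (_ @^-1` _))
  -integral_indic//.
Qed.

Lemma branch_map_snd r (w : hist r.+1) i l (P : probability (mR * Rd R r)%type
  R)
    (B : set (Rd R r.+1)) : measurable B ->
  (unif \x P) (branch_map (s := s) w (i, l) @^-1` (snd @^-1` B)) =
  \int[unif]_t P (snd @^-1` slice B (affine_map (i%:R / n%:R) n%:R^-1 (folds l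
    t))).
Proof.
move=> mB; rewrite /product_measure1; apply: eq_integral => t _ /=.
congr (P _); apply/seteqP; split=> z /=; rewrite /xsection /= inE//.
Qed.

End CouplingExists.

Section CouplingStep.
Context {R : realType} {n s : nat}.
Local Notation mR := (measurableTypeR R).
Local Notation mu := (@lebesgue_measure R).
Local Notation hist := (@hist R n).
Local Open Scope ereal_scope.

(** Averaging over the [2 ^ s] foldings restores the uniform law; this is how the dyadic cells
    disappear from both marginals. *)
Lemma sum_branch_integral r (w : hist r.+1) (G : 'I_n -> mR -> \bar R) :
  (0 < n)%N -> (forall k, 0 < w k)%R ->
  (forall i, measurable_fun [set: mR] (G i)) -> (forall i t, 0 <= G i t) ->
  \sum_(il : 'I_n * bits s) (branch_weight w il)%:E *
    \int[unif]_t G il.1 (folds il.2 t) =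
  \sum_i (marginal w i)%:E * \int[unif]_t G i t.
Proof.
move=> n0 w0 mG G0.
rewrite -(pair_bigA _ (fun i l => (branch_weight w (i, l))%:E *
  \int[unif]_t G i (folds l t))) /=.
apply: eq_bigr => i _; rewrite (integral_unif_folds s (mG i) (G0 i)).
rewrite ge0_sume_distrr; first by apply: eq_bigr => l _; rewrite muleA -EFinM.
move=> l _; apply: mule_ge0; first by rewrite lee_fin exprn_ge0// invr_ge0.
by apply: integral_ge0 => t _; exact: G0.
Qed.

Lemma measurable_prob_slice r (P : probability (mR * Rd R r)%type R)
    (B : set (Rd R r.+1)) : measurable B ->
  measurable_fun [set: mR] (fun x : mR => P (snd @^-1` slice B x)).
Proof.
move=> mB.
have mS : measurable [set z : mR * (mR * Rd R r) | slice B z.1 z.2.2].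
  rewrite -[X in measurable X]setTI.
  apply: (measurable_cons_row measurable_fst _) => //.
  exact: (measurableT_comp measurable_snd measurable_snd).
apply: eq_measurable_fun (measurable_fun_xsection P mS) => x _ /=.
by congr (P _); apply/seteqP; split=> z /=; rewrite /xsection /= inE.
Qed.

Lemma hist_coupling_exists r (w : hist r) : (0 < n)%N -> (0 < s)%N ->
  (forall k, 0 < w k)%R -> exists P, hist_coupling (s := s) w P.
Proof.
move=> n0 s0; elim: r w => [w _|r ih w w0]; first exact: hist_coupling0.
have w0' i k : (0 < subhist w i k)%R by exact: w0.
have [P PP] := choice (fun i => ih (subhist w i) (w0' i)).
(* [Q il] is the law on branch [il]; the mixture below weights it by the length of the input
   interval that the branch covers. *)
have [Q QP] := choice (fun il => pushforward_probability
  (unif \x P il.1 : probability _ R) (measurable_branch_map (s := s) w il)).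
have bw0 il : (0 <= branch_weight (s := s) w il)%R.
  by rewrite mulr_ge0 ?exprn_ge0 ?invr_ge0// ltW// marginal_gt0.
have [PQ PQE] := mixture_probability Q bw0 (sum_branch_weight n0 w0).
exists PQ; split=> [A mA|B mB|].
- have mA1 : measurable_fun [set: mR] (fun t : mR => (\1_A t)%:E : \bar R).
    by apply/measurable_EFinP; apply: measurable_indic.
  rewrite PQE -[A in RHS]setIT -integral_indic//.
  rewrite (integral_unif_cells (fun i => marginal_gt0 i n0 w0) (sum_marginal
    n0 w0) mA1)//.
  rewrite -sum_branch_integral//.
  + apply: eq_bigr => -[i l] _; rewrite (QP _).1; congr (_ * _).
    exact: (branch_map_fst l (PP i) mA).
  + by move=> i; exact: (measurableT_comp mA1 (measurable_affine_map _ _)).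
- pose H i (x : mR) := P i (snd @^-1` slice B x).
  have mH i : measurable_fun [set: mR] (H i) by exact: measurable_prob_slice.
  have H0 i x : 0 <= H i x by exact: measure_ge0.
  have ninv : (0 < n%:R^-1 :> R)%R by rewrite invr_gt0 ltr0n.
  transitivity ((total w)%:E * \sum_i (marginal w i)%:E *
      \int[unif]_t H i (affine_map (i%:R / n%:R) n%:R^-1 t)).
    congr (_ * _); rewrite PQE -sum_branch_integral//.
    + apply: eq_bigr => -[i l] _; rewrite (QP _).1; congr (_ * _).
      exact: branch_map_snd.
    + by move=> i; exact: (measurableT_comp (mH i) (measurable_affine_map _ _)).
  rewrite dens_measure_slices// !ge0_sume_distrr; last 2 first.
  + move=> i _; apply: integral_ge0 => t _; apply: lebesgue_int_ge0 => v.
    by rewrite lee_fin mulr_ge0// pw_density_ge0.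
  + move=> i _; apply: mule_ge0; first by rewrite lee_fin ltW// marginal_gt0.
    by apply: integral_ge0 => t _; exact: H0.
  apply: eq_bigr => i _.
  have tw0 : (total w != 0)%R by rewrite gt_eqF// total_gt0.
  (* [total w * marginal w i] is the mass of the sub-histogram, to which the induction hypothesis
     applies slice by slice. The factor [n] split off here cancels against the cell width [1 / n] at
     the end. *)
  rewrite muleA -EFinM mulrC divfK// exprS EFinM -muleA.
  rewrite -[X in _ = _ * X]ge0_integralZl//; last 3 first.
  + exact: measurable_itv.
  + by apply: measurable_funTS; exact: measurable_dens_slice.
  + move=> t _; apply: lebesgue_int_ge0 => v.
    by rewrite lee_fin mulr_ge0// pw_density_ge0.
  rewrite (eq_integral (fun t => (total (subhist w i))%:E * H i t)); last first.
    move=> t _; have [_ P2 _] := PP i.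
    by rewrite -P2//; exact: measurable_slice.
  rewrite [X in _ = _ * X]ge0_integralZl//; last 2 first.
  + exact: measurable_funTS.
  + by rewrite lee_fin ltW// total_gt0.
  rewrite muleCA; congr (_ * _); rewrite /cell.
  rewrite [X in `[_, X]%classic](_ : _ = i%:R / n%:R + n%:R^-1)%R; last first.
    by rewrite -natr1 mulrDl mul1r.
  rewrite integral_itv_unif// muleA -EFinM divff ?mul1e// pnatr_eq0.
    by rewrite -lt0n.
  exact: measurable_itv.
- rewrite PQE; apply: big1 => -[i l] _; rewrite (QP _).1.
  rewrite [X in _ * X](_ : _ = 0) ?mule0//.
  exact: (branch_map_null l n0 s0 w0 (PP i)).
Qed.

End CouplingStep.

(** * From coordinatewise closeness to the transport bound *)

Lemma measurable_enorm (R : realType) d :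
  measurable_fun [set: Rd R d] (@enorm R d : Rd R d -> measurableTypeR R).
Proof.
have msqrt : measurable_fun [set: measurableTypeR R]
    (Num.sqrt : measurableTypeR R -> measurableTypeR R).
  by apply: continuous_measurable_fun; exact: sqrt_continuous.
apply: (measurableT_comp msqrt); apply: measurable_sum => j.
apply: (measurableT_comp (exprn_measurable 2)); exact: measurable_coord.
Qed.

Lemma enorm_le (R : realType) d (v : 'rV[R]_d) (e : R) : 0 <= e ->
  (forall j, `|v ord0 j| <= e) -> enorm v <= Num.sqrt d%:R * e.
Proof.
move=> e0 ve; rewrite -[X in _ * X](ger0_norm e0) -sqrtr_sqr -sqrtrM ?ler0n//.
apply: ler_wsqrtr; rewrite mulrC mulr_natr -[in leRHS](card_ord d) -sumr_const.
by apply: ler_sum => j _; rewrite -real_normK ?num_real// lerXn2r ?nnegrE.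
Qed.

Theorem mainTheorem9 (R : realType) (d n s : nat) :
  (1 <= d)%N -> (1 <= n)%N -> (1 <= s)%N ->
  forall p : 'rV[R]_d -> R, in_E n p ->
  exists Psi : relu_net R 1 d,
    (net_conn Psi <= 22 * 2 ^ d * (n ^ d + n ^ (d - 1) * s))%N /\
    net_depth Psi = ((d - 1) * (s + 3) + 2)%N /\
    (wasserstein1 (push_unif (net_fun1 Psi)) (dens_measure p)
      <= (Num.sqrt d%:R / (n%:R * 2%:R ^+ s))%:E)%E.
Proof.
case: d => // r _ n0 s0 p [w [w0 [w1 ->]]]; rewrite subn1 /=.
have [Psi [PsiC PsiD PsiE]] := hist_net w n0 s0.
exists Psi; split=> //; split=> //.
have [P [P1 P2 P3]] := hist_coupling_exists n0 s0 w0.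
have mPsi : measurable_fun [set: measurableTypeR R]
    (net_fun1 Psi : measurableTypeR R -> Rd R r.+1).
  apply: measurable_fun_Rd => j.
  under eq_fun do rewrite PsiE mxE.
  exact: measurable_hist_map.
pose g (z : measurableTypeR R * Rd R r.+1) : Rd R r.+1 * Rd R r.+1 :=
  (net_fun1 Psi z.1, z.2).
have mg : measurable_fun setT g.
  apply: measurable_fun_pair => //.
  exact: (measurableT_comp mPsi measurable_fst).
(* Applying the network to the input component turns the coupling of the input with the target into
   a coupling of the output with the target. *)
have [Q [QE QI]] := pushforward_probability P mg.
pose E (z : Rd R r.+1 * Rd R r.+1) : \bar R :=
  (enorm ((z.1 : 'rV[R]_r.+1) - z.2))%:E.
have mE : measurable_fun setT E.
  have md : measurable_fun setT (fun z : Rd R r.+1 * Rd R r.+1 =>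
      (z.1 : 'rV[R]_r.+1) - z.2 : Rd R r.+1).
    apply: measurable_fun_Rd => j; under eq_fun do rewrite !mxE.
    apply: measurable_funB.
      exact: (measurableT_comp (measurable_coord j) measurable_fst).
    exact: (measurableT_comp (measurable_coord j) measurable_snd).
  by apply/measurable_EFinP;
    exact: (measurableT_comp (@measurable_enorm R r.+1) md).
have E0 z : (0 <= E z)%E by rewrite lee_fin sqrtr_ge0.
apply: (@le_trans _ _ (\int[Q]_z E z)%E).
  apply: ereal_inf_lbound; exists Q => //= A mA; rewrite !QE; split.
    transitivity (P (fst @^-1` (net_fun1 Psi @^-1` A))) => //.
    have mA' : measurable (net_fun1 Psi @^-1` A : set (measurableTypeR R)).
      by rewrite -[X in measurable X]setTI; exact: mPsi.
    by rewrite P1// unifE.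
  transitivity (P (snd @^-1` A)) => //.
  have nr0 : n%:R ^+ r.+1 != 0 :> R by rewrite expf_neq0// pnatr_eq0 -lt0n.
  (* The total weight is [n ^ r.+1], so both normalizing factors in [P2] cancel. *)
  have := congr1 (mule ((n%:R ^+ r.+1)^-1)%:E) (P2 A mA).
  by rewrite /total w1 !muleA -EFinM mulVf// !mul1e.
rewrite QI//.
pose b := Num.sqrt r.+1%:R / (n%:R * 2%:R ^+ s) : R.
have b0 : 0 <= b by rewrite divr_ge0 ?sqrtr_ge0 ?mulr_ge0 ?exprn_ge0.
apply: (@le_trans _ _ (\int[P]_x (cst b%:E) x)%E).
  apply: ae_ge0_le_integral => //.
  - exact: (measurableT_comp mE mg).
  (* The cost is bounded by [b] only off this null set, hence the almost-everywhere comparison of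
     integrals. *)
  - exists (~` close_pairs (s := s) w); split=> //.
      by apply: measurableC; exact: measurable_close_pairs.
    move=> z /= zb zc; apply: zb => _; rewrite lee_fin /b invfM.
    rewrite -exprVn; apply: enorm_le => [|j].
      by rewrite mulr_ge0 ?exprn_ge0 ?invr_ge0.
    by rewrite /g PsiE !mxE; exact: zc.
rewrite integral_cst// -[leRHS]mule1; apply: lee_wpmul2l;
  first by rewrite lee_fin.
by rewrite -(probability_setT P).
Qed.
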